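(* Let $u$ and $v$ be weight functions on a homogeneous Lie group $\mathbb{G}$ of homogeneous dimension $Q$, equipped with an arbitrary quasi-norm $|\cdot|$, and let $0<p\le q<\infty$ and $\epsilon>0$. Then there exists a positive constant $C$ such that, for all positive functions $f$ on $\mathbb{G}$, the inequality $$\left(\int_{\mathbb{G}}\left[\exp\left(\epsilon\,|\mathbb{B}(0,|x|)|^{\epsilon}\int_{\mathbb{G}\setminus\mathbb{B}(0,|x|)}|\mathbb{B}(0,|y|)|^{-\epsilon-1}\log f(y)\,dy\right)\right]^q u(x)\,dx\right)^{\frac1q}\le C\left(\int_{\mathbb{G}}f^p(x)\,v(x)\,dx\right)^{\frac1p}$$ holds, provided that $$\tilde D_Q:=\sup_{x\in\mathbb{G}}|\mathbb{B}(0,|x|)|^{\frac1q-\frac1p}\,\tilde u^{\frac1q}(x)\left[\exp\left(\frac{1}{|\mathbb{B}(0,|x|)|}\int_{\mathbb{B}(0,|x|)}\log\frac{1}{\tilde v(y)}\,dy\right)\right]^{\frac1p}<\infty,$$ where $$\tilde u(s)=u\big(s^{-\frac1\epsilon}\big)\,\frac1\epsilon\,|s|^{-Q\left(1+\frac1\epsilon\right)},\qquad \tilde v(s)=v\big(s^{-\frac1\epsilon}\big)\,\frac1\epsilon\,|s|^{-Q\left(1+\frac1\epsilon\right)},$$ and where, for $s=r\sigma$ with $r=|s|>0$ and $|\sigma|=1$, $s^{-1/\epsilon}$ denotes the point $r^{-1/\epsilon}\sigma$. Moreover, the optimal constant $C$ in the inequality satisfies $$0<C\le\left(\frac pq\right)^{\frac1q}\exp\left(\frac1p\right)\tilde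 D_Q .$$
   Context: A homogeneous group $\mathbb{G}$ is a Lie group identified with $(\mathbb{R}^N,\circ)$ equipped with dilations $D_\lambda(x)=(\lambda^{v_1}x_1,\dots,\lambda^{v_N}x_N)$, $v_1,\dots,v_N>0$, which are automorphisms of the group for every $\lambda>0$; one writes $\lambda x$ for $D_\lambda(x)$ (so $r\sigma$ means $D_r(\sigma)$). Its homogeneous dimension is $Q=v_1+\dots+v_N$. The Haar measure $dx$ is Lebesgue measure on $\mathbb{R}^N$, and $|\omega|$ denotes the Haar measure of a measurable set $\omega\subset\mathbb{G}$. A quasi-norm is a continuous function $|\cdot|:\mathbb{G}\to[0,\infty)$ with $|x^{-1}|=|x|$ for all $x$, $|\lambda x|=\lambda|x|$ for all $x$ and $\lambda>0$, and $|x|=0$ if and only if $x=0$. $\mathbb{B}(0,r)$ is the quasi-ball $\{y\in\mathbb{G}:|y|<r\}$. With $\mathfrak{S}=\{x\in\mathbb{G}:|x|=1\}$ and $\sigma$ the unique Radon measure on $\mathfrak{S}$ such that $\int_{\mathbb{G}}f(x)\,dx=\int_0^\infty\int_{\mathfrak{S}}f(ry)\,r^{Q-1}\,d\sigma(y)\,dr$ for all $f\in L^1(\mathbb{G})$, one has $|\mathbb{B}(0,|x|)|=|x|^Q|\mathfrak{S}|/Q$, where $|\mathfrak{S}|=\sigma(\mathfrak{S})$. Weight functions are positive functions on $\mathbb{G}$. The optimal constant is the least $C$ for which the inequality holds for all positive functions $f$.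
   Formalization: The positivity 0 < C of the optimal constant (and that the least constant is attained) is proved only when D̃_Q > 0; if D̃_Q = 0, e.g. ṽ(s) = exp(|s|^{-Q}), the claim 0 < C ≤ 0 is impossible. *)

(* Defs.v *)
From HB Require Import structures.
From mathcomp Require Import all_boot all_order all_algebra.
From mathcomp Require Import all_classical all_reals all_analysis.

Set Implicit Arguments.
Unset Strict Implicit.
Unset Printing Implicit Defensive.

Import Order.TTheory GRing.Theory Num.Theory.
Import numFieldNormedType.Exports.

Local Open Scope classical_set_scope.
Local Open Scope ring_scope.

(* The sigma-algebra on R^n is generated by the coordinate projections, as the
   library does for n.-tuple; it is the Borel sigma-algebra. *)
Section measurable_rV.
Context {R : realType} (n : nat).

Let coord_rV : 'I_n -> 'rV[R]_n -> R := fun i x => x ord0 i.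

Let rV_set0 : g_sigma_preimage coord_rV set0.
Proof. exact: sigma_algebra0. Qed.

Let rV_setC A : g_sigma_preimage coord_rV A -> g_sigma_preimage coord_rV (~` A).
Proof. exact: sigma_algebraC. Qed.

Let rV_bigcup (F : _^nat) : (forall i, g_sigma_preimage coord_rV (F i)) ->
  g_sigma_preimage coord_rV (\bigcup_i (F i)).
Proof. exact: sigma_algebra_bigcup. Qed.

HB.instance Definition _ := @isMeasurable.Build default_measure_display
  'rV[R]_n (g_sigma_preimage coord_rV) rV_set0 rV_setC rV_bigcup.

Lemma measurable_coord_rV (i : 'I_n) :
  measurable_fun setT (fun x : 'rV[R]_n => x ord0 i).
Proof.
move=> _ A mA; apply: sub_sigma_algebra.
rewrite -bigcup_seq; exists i => /=; first by rewrite mem_index_enum.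
by exists A.
Qed.

Lemma measurable_fun_rV d (T : measurableType d) (f : T -> 'rV[R]_n) :
  (forall i, measurable_fun setT (fun t => f t ord0 i)) ->
  measurable_fun setT f.
Proof.
move=> mf; apply: (@measurability _ _ _ _ setT f
  (\big[setU/set0]_(i < n) preimage_set_system setT (coord_rV i) measurable)).
  by [].
move=> _ [B HB <-]; move: HB; rewrite -bigcup_seq => -[i _ [A mA <-]].
by have := mf i measurableT A mA; rewrite !setTI.
Qed.

End measurable_rV.

Definition cons_rV (R : realType) n (z : R * 'rV[R]_n) : 'rV[R]_n.+1 :=
  row_mx (const_mx z.1 : 'rV[R]_1) z.2.

Definition uncons_rV (R : realType) n (x : 'rV[R]_n.+1) : R * 'rV[R]_n :=
  (x ord0 ord0, \row_j x ord0 (lift ord0 j)).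

Section cons_rV.
Context {R : realType} (n : nat).

Lemma cons_rV0 (z : R * 'rV[R]_n) : cons_rV z ord0 ord0 = z.1.
Proof.
rewrite /cons_rV mxE; case: splitP => [j _|k]; first by rewrite mxE.
by [].
Qed.

Lemma cons_rVS (z : R * 'rV[R]_n) j : cons_rV z ord0 (lift ord0 j) = z.2 ord0 j.
Proof.
rewrite /cons_rV mxE; case: splitP => [k|k /eqP]; first by rewrite ord1.
by rewrite /= eqSS => /eqP/val_inj <-.
Qed.

Lemma cons_rVK : cancel (@cons_rV R n) (@uncons_rV R n).
Proof.
move=> [x y]; rewrite /uncons_rV cons_rV0; congr pair.
by apply/rowP => j; rewrite mxE cons_rVS.
Qed.

Lemma measurable_cons_rV : measurable_fun setT (@cons_rV R n).
Proof.
apply: measurable_fun_rV => i; case: (unliftP ord0 i) => [j ->|->].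
  under eq_fun do rewrite cons_rVS.
  exact: (measurableT_comp (measurable_coord_rV j) measurable_snd).
under eq_fun do rewrite cons_rV0.
exact: measurable_fst.
Qed.

Lemma measurable_uncons_rV : measurable_fun setT (@uncons_rV R n).
Proof.
apply: measurable_fun_pair; first exact: measurable_coord_rV.
apply: measurable_fun_rV => i.
by under eq_fun do rewrite mxE; exact: measurable_coord_rV.
Qed.

End cons_rV.

Section lebesgue_rV.
Local Open Scope ereal_scope.
Context {R : realType}.

Section cons_measure.
Variable (n : nat) (mu : {sigma_finite_measure set 'rV[R]_n -> \bar R}).

Definition cons_measure : set 'rV[R]_n.+1 -> \bar R :=
  pushforward (@lebesgue_measure R \x mu) (@cons_rV R n).

Let cons_measure0 : cons_measure set0 = 0.
Proof. by rewrite /cons_measure /pushforward preimage_set0 measure0. Qed.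

Let cons_measure_ge0 A : 0 <= cons_measure A.
Proof. by rewrite /cons_measure /pushforward measure_ge0. Qed.

Let cons_measure_sigma_additive : semi_sigma_additive cons_measure.
Proof.
move=> F mF tF mUF; rewrite /cons_measure /pushforward preimage_bigcup.
have mcons A : measurable A -> measurable (@cons_rV R n @^-1` A).
  by move=> mA; rewrite -[X in measurable X]setTI; exact: measurable_cons_rV.
apply: measure_semi_sigma_additive.
- by move=> k; exact: mcons.
- apply/trivIsetP => /= i j _ _ ij; rewrite -preimage_setI.
  by move/trivIsetP : tF => /(_ _ _ _ _ ij) ->//; rewrite preimage_set0.
- by rewrite -preimage_bigcup; exact: mcons.
Qed.

HB.instance Definition _ := isMeasure.Build _ _ _
  cons_measure cons_measure0 cons_measure_ge0 cons_measure_sigma_additive.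

Let sigma_finite_cons_measure : sigma_finite setT cons_measure.
Proof.
have /sigma_finiteP[F [FT ndF Foo]] := sigma_finiteT (@lebesgue_measure R).
have /sigma_finiteP[H [HT ndH Hoo]] := sigma_finiteT mu.
exists (fun k => @uncons_rV R n @^-1` (F k `*` H k)).
  rewrite -preimage_bigcup; apply/seteqP; split => // x _.
  have [i _ Fi] : (\bigcup_k F k) (uncons_rV x).1 by rewrite -FT.
  have [j _ Hj] : (\bigcup_k H k) (uncons_rV x).2 by rewrite -HT.
  exists (maxn i j) => //; split.
    by move: Fi; exact/subsetPset/ndF/leq_maxl.
  by move: Hj; exact/subsetPset/ndH/leq_maxr.
move=> k; have [mF Fk] := Foo k; have [mH Hk] := Hoo k; split.
  rewrite -[X in measurable X]setTI; apply: measurable_uncons_rV => //.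
  exact: measurableX.
rewrite /cons_measure /pushforward -comp_preimage.
rewrite (_ : _ \o _ = id) ?preimage_id; last exact/funext/cons_rVK.
by rewrite product_measure1E// lte_mul_pinfty// ge0_fin_numE.
Qed.

HB.instance Definition _ :=
  Measure_isSigmaFinite.Build _ _ _ cons_measure sigma_finite_cons_measure.

End cons_measure.

(* Lebesgue measure on R^n, as an iterated product of lebesgue_measure *)
Fixpoint lebesgue_rV (n : nat) : {sigma_finite_measure set 'rV[R]_n -> \bar R} :=
  match n with
  | 0 => [the sigma_finite_measure _ _ of \d_(0%R : 'rV[R]_0)]
  | m.+1 => [the sigma_finite_measure _ _ of cons_measure (lebesgue_rV m)]
  end.

Lemma lebesgue_rV_box n (A : 'I_n -> set R) : (forall i, measurable (A i)) ->
  lebesgue_rV n [set x | forall i, A i (x ord0 i)] =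
  \prod_(i < n) lebesgue_measure (A i).
Proof.
elim: n A => [A _|n IH A mA].
  rewrite big_ord0 /= diracE mem_set// => i; by case: i.
pose B : set 'rV[R]_n := [set x | forall i, A (lift ord0 i) (x ord0 i)].
have mB : measurable B.
  rewrite (_ : B = \bigcap_(i in [set: 'I_n])
    ((fun x : 'rV[R]_n => x ord0 i) @^-1` A (lift ord0 i))); last first.
    by apply/seteqP; split => [x h i _|x h i]; exact: h.
  apply: fin_bigcap_measurable => // i _.
  by rewrite -[X in measurable X]setTI; exact: measurable_coord_rV.
have consE : @cons_rV R n @^-1` [set x | forall i, A i (x ord0 i)] =
    A ord0 `*` B.
  apply/seteqP; split => [z h|z [h0 hS] i].
    by split => [|i]; [rewrite -cons_rV0|rewrite -cons_rVS]; exact: h.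
  by case: (unliftP ord0 i) => [j ->|->]; [rewrite cons_rVS|rewrite cons_rV0].
rewrite big_ord_recl -IH// -product_measure1E//=; last exact: mA.
by rewrite /cons_measure /pushforward consE.
Qed.

End lebesgue_rV.

(* C^k maps. In finite dimension, being differentiable with C^k directional
   derivatives amounts to being C^(k+1). *)
Fixpoint Ck (R : realType) (V W : normedModType R) (k : nat) (f : V -> W) :
    Prop :=
  match k with
  | 0 => continuous f
  | j.+1 => (forall x, differentiable f x) /\
            (forall v : V, Ck j (fun x => 'D_v f x))
  end.

Definition smooth (R : realType) (V W : normedModType R) (f : V -> W) : Prop :=
  forall k, Ck k f.

(* (lambda^(v_1) x_1, ..., lambda^(v_N) x_N) *)
Definition dilation (R : realType) (N : nat) (v : 'I_N -> R) (lambda : R)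
    (x : 'rV[R]_N) : 'rV[R]_N :=
  \row_i (lambda `^ v i * x ord0 i).

(* The dilations are bijective for lambda > 0, so that being multiplicative
   makes them automorphisms; this forces hg_one = 0. *)
Record homogeneous_group (R : realType) (N : nat) := HomogeneousGroup {
  hg_mul : 'rV[R]_N -> 'rV[R]_N -> 'rV[R]_N;
  hg_inv : 'rV[R]_N -> 'rV[R]_N;
  hg_one : 'rV[R]_N;
  hg_wt : 'I_N -> R;
  hg_mulA : associative hg_mul;
  hg_mul1 : left_id hg_one hg_mul;
  hg_1mul : right_id hg_one hg_mul;
  hg_mulV : left_inverse hg_one hg_inv hg_mul;
  hg_Vmul : right_inverse hg_one hg_inv hg_mul;
  hg_smooth_mul :
    smooth (fun z : ('rV[R]_N * 'rV[R]_N)%type => hg_mul z.1 z.2);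
  hg_smooth_inv : smooth hg_inv;
  hg_wt_gt0 : forall i, 0 < hg_wt i;
  hg_dilationM : forall lambda, 0 < lambda ->
    {morph dilation hg_wt lambda : x y / hg_mul x y} }.

Record quasi_norm (R : realType) (N : nat) (G : homogeneous_group R N) :=
    QuasiNorm {
  qn :> 'rV[R]_N -> R;
  qn_continuous : continuous qn;
  qn_ge0 : forall x, 0 <= qn x;
  qnV : forall x, qn (hg_inv G x) = qn x;
  qnZ : forall x lambda, 0 < lambda ->
    qn (dilation (hg_wt G) lambda x) = lambda * qn x;
  qn_eq0 : forall x, qn x = 0 <-> x = 0 }.

Section hardy.
Context {R : realType} (N : nat) (G : homogeneous_group R N).
Variable nrm : quasi_norm G.

Definition hdim : R := \sum_(i < N) hg_wt G i.

Definition qball (r : R) : set 'rV[R]_N := [set y | nrm y < r].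

(* |B(0, r)|, a finite number *)
Definition qvol (r : R) : R := fine (lebesgue_rV N (qball r)).

Definition is_weight (w : 'rV[R]_N -> R) : Prop :=
  measurable_fun setT w /\ forall x, 0 < w x.

(* For s = r sigma with r = |s| > 0 and |sigma| = 1, the point r^a sigma. *)
Definition radial_pow (s : 'rV[R]_N) (a : R) : 'rV[R]_N :=
  let sigma := dilation (hg_wt G) (nrm s)^-1 s in
  dilation (hg_wt G) (nrm s `^ a) sigma.

Definition tilde (eps : R) (w : 'rV[R]_N -> R) (s : 'rV[R]_N) : R :=
  w (radial_pow s (- eps^-1)) * eps^-1 *
  nrm s `^ (- (hdim * (1 + eps^-1))).

Local Open Scope ereal_scope.

(* exp of the inner integral, valued in [0, +oo] (exp(-oo) = 0); the integral
   is -oo when the positive and negative parts of its integrand both have an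
   infinite integral. *)
Definition geom_mean_op (eps : R) (f : 'rV[R]_N -> R) (x : 'rV[R]_N) : \bar R :=
  expeR ((eps * qvol (nrm x) `^ eps)%:E *
    \int[lebesgue_rV N]_(y in ~` qball (nrm x))
      (qvol (nrm y) `^ (- eps - 1) * ln (f y))%:E).

Definition hardy_ineq (u v : 'rV[R]_N -> R) (p q eps C : R) : Prop :=
  forall f : 'rV[R]_N -> R, measurable_fun setT f -> (forall x, (0 < f x)%R) ->
    (\int[lebesgue_rV N]_x (geom_mean_op eps f x `^ q * (u x)%:E)) `^ q^-1 <=
    C%:E * (\int[lebesgue_rV N]_x (f x `^ p * v x)%:E) `^ p^-1.

(* The supremum is over x != 0, where the expression is defined. *)
Definition Dtilde (u v : 'rV[R]_N -> R) (p q eps : R) : \bar R :=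
  ereal_sup [set
    (qvol (nrm x) `^ (q^-1 - p^-1) * tilde eps u x `^ q^-1)%:E *
    expeR ((qvol (nrm x))^-1%:E *
      \int[lebesgue_rV N]_(y in qball (nrm x)) (ln (tilde eps v y)^-1)%:E)
      `^ p^-1
  | x in [set x : 'rV[R]_N | x != 0%R]].

(* Constants are taken positive because 0 * +oo = 0 in \bar R. *)
Definition optimal_constant (u v : 'rV[R]_N -> R) (p q eps : R) : R :=
  inf [set C : R | (0 < C)%R /\ hardy_ineq u v p q eps C].

End hardy.

(* Main.v *)
Require Import Defs.
From HB Require Import structures.
From mathcomp Require Import all_boot all_order all_algebra.
From mathcomp Require Import all_classical all_reals all_analysis.
From mathcomp Require Import measurable_realfun ring lra.
Set Implicit Arguments.
Unset Strict Implicit.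
Unset Printing Implicit Defensive.
Import Order.TTheory GRing.Theory Num.Theory.
Import numFieldNormedType.Exports.
Local Open Scope classical_set_scope.
Local Open Scope ring_scope.

(** The substitution s |-> s^(-1/eps) turns the inequality into one for the
geometric mean over the ball through a point.  Write b(x) for the volume of the
quasi-ball through x, so that Lebesgue measure mu gives mass t to {0 < b <= t}.
Along the substitution Lebesgue measure acquires the density
J(s) = eps^-1 |s|^(-Q (1 + 1/eps)), which is the factor built into the tilde
weights; the complement of a ball becomes a ball; and the operator becomes
exp (b(x)^-1 int_{b <= b(x)} log f~), because the power of b in its kernel times
J is a constant ([ge0_integral_radial], [geom_mean_op_radial]).

What remains ([hardy_on_volume]) uses b alone and makes sense on any measure
space carrying a function b with mu {0 < b <= t} = t.  Put k = q / p >= 1,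
g = f^p v, A = int g, and let M denote the mean over {b <= t}, t = b(x).  The
definition of the supremum D absorbs the weights and leaves
exp(M log g)^k t^(k-1) to be integrated.  Since int_{b <= t} log b = t log t - t,
  exp(M log g)^k = e^k t^(-k) exp(M log (g b^k)) exp(M log g)^(k-1),
and Jensen's inequality for exp and log, used once for g b^k and once for g,
bounds this by e^k t^(-2k) A^(k-1) int_{b <= t} g b^k.  By Tonelli and
int_{b >= tau} b^(-k-1) = tau^(-k) / k the integral over x of
t^(k-1) times that bound is e^k A^k / k, and the q-th root of D^q e^k A^k / k is
(p/q)^(1/q) e^(1/p) D A^(1/p).

The change of variables is a comparison of two measures.  A point x other than 0
is recovered from b(x) and from its direction x/|x|, so a measure is determined
by its values on the sets {direction in E, 0 < b <= t}.  The dilation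
of ratio r multiplies Lebesgue measure by r^Q, so there it has the value c(E) t;
integrating a power of b over a cone shows that the image of J mu has the same
value ([measure_cone], [measure_cone_radial], [polar_measure_unique]).

Integrals of logarithms need not converge, and an integral both of whose parts
are infinite has the value -oo.  This does no harm: if the negative
part of log f and f^p v are integrable, then log^+ v is integrable, so the integral
of log (1/v) is well defined, and it is finite as soon as D is
([integrable_ln_weighted]).

Finally the best constant is attained because the inequality is closed in C, and
it is positive because some f makes the left-hand side positive and the right-hand
side finite ([Dtilde_test_function]). *)

(** * Comparison of integrals and Jensen's inequality *)

Section integral_complements.
Local Open Scope ereal_scope.
Context d (T : measurableType d) (R : realType).
Variable mu : {measure set T -> \bar R}.
Implicit Types (D : set T) (F G : T -> R).

(** The integral is a difference of two suprema over simple functions, and each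
of them is monotone. When both parts are infinite the value is -oo, which is
compatible with the order. *)
Lemma integral_mono D (f g : T -> \bar R) : (forall x, D x -> f x <= g x) ->
  \int[mu]_(x in D) f x <= \int[mu]_(x in D) g x.
Proof.
move=> fg; have fg' x : (f \_ D) x <= (g \_ D) x.
  by rewrite !patchE; case: ifPn => // /set_mem; exact: fg.
rewrite /integral; apply: leeB; apply: le_ereal_sup => _ [h hle <-]; exists h => // x.
  by apply: (le_trans (hle x)); apply: (@funepos_le _ _ setT) => [y _|]; [exact: fg'|exact: in_setT].
by apply: (le_trans (hle x)); apply: (@funeneg_le _ _ setT) => [y _|]; [exact: fg'|exact: in_setT].
Qed.

Lemma integral_neg_lty D F :
  -oo < \int[mu]_(x in D) (F x)%:E ->
  \int[mu]_(x in D) ((EFin \o F)^\- x) < +oo.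
Proof.
rewrite integralE; rewrite ltey; apply: contraTN => /eqP ->.
by rewrite /= addeNy.
Qed.

Lemma integrable_posneg D F : measurable D -> measurable_fun D F ->
  \int[mu]_(x in D) ((EFin \o F)^\+ x) < +oo ->
  \int[mu]_(x in D) ((EFin \o F)^\- x) < +oo ->
  mu.-integrable D (EFin \o F).
Proof.
move=> mD mF Fp Fn; have mF' : measurable_fun D (fun x => (F x)%:E) by exact/measurable_EFinP.
apply/integrableP; split => //.
under eq_integral => x _ do rewrite -[`|_|]/((abse \o (EFin \o F)) x) fune_abse.
rewrite ge0_integralD//; first exact: lte_add_pinfty.
- exact: measurable_funepos.
- exact: measurable_funeneg.
Qed.

Lemma integral_fin_integrable D F : measurable D -> measurable_fun D F ->
  \int[mu]_(x in D) (F x)%:E < +oo ->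
  \int[mu]_(x in D) ((EFin \o F)^\- x) < +oo ->
  mu.-integrable D (EFin \o F).
Proof.
move=> mD mF Foo Fn; apply: integrable_posneg => //.
move: Foo; rewrite integralE ltey => Foo; rewrite ltey; apply: contraNN Foo => /eqP E.
rewrite [X in X - _]E addye//.
by rewrite eqe_oppLR/= lt_eqF.
Qed.

(** Jensen's inequality, from the tangent line of the logarithm: log h <= h / c
- 1 + log c for every c > 0, and c is taken just above the mean of h so that a
zero mean needs no separate argument. The integral of log h may be -oo. *)
Lemma expeR_mean_ln D (t : R) (h : T -> R) :
  measurable D -> mu D = t%:E -> (0 < t)%R -> measurable_fun D h ->
  (forall x, D x -> (0 < h x)%R) ->
  expeR (t^-1%:E * \int[mu]_(x in D) (ln (h x))%:E) <=
  t^-1%:E * \int[mu]_(x in D) (h x)%:E.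
Proof.
move=> mD muD t0 mh h0.
have ih0 : 0 <= \int[mu]_(x in D) (h x)%:E.
  by apply: integral_ge0 => x Dx; rewrite lee_fin ltW// h0.
have [ioo|] := ltP (\int[mu]_(x in D) (h x)%:E) +oo; last first.
  by rewrite leye_eq => /eqP ->; rewrite gt0_muley ?leey// lte_fin invr_gt0.
have [i iE] : exists i, \int[mu]_(x in D) (h x)%:E = i%:E.
  by exists (fine (\int[mu]_(x in D) (h x)%:E)); rewrite fineK// ge0_fin_numE.
rewrite iE -EFinM; apply/lee_addgt0Pr => e e0.
have i0 : (0 <= i)%R by rewrite -lee_fin -iE.
pose c := (t^-1 * i + e)%R.
have c0 : (0 < c)%R by rewrite ltr_wpDl// mulr_ge0// invr_ge0 ltW.
have hint : mu.-integrable D (EFin \o h).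
  apply/integrableP; split; first exact/measurable_EFinP.
  rewrite (eq_integral (EFin \o h)) ?iE ?ltry// => x /set_mem Dx /=.
  by rewrite ger0_norm// ltW// h0.
have kint (k : R) : mu.-integrable D (EFin \o cst k).
  apply/integrableP; split; first exact/measurable_EFinP.
  by rewrite /= integral_cst// muD -EFinM ltry.
have le1 : \int[mu]_(x in D) (ln (h x))%:E <=
    \int[mu]_(x in D) ((c^-1)%:E * (h x)%:E + (ln c - 1)%:E).
  apply: integral_mono => x Dx; rewrite -EFinM -EFinD lee_fin.
  have /le_ln1Dx : (-1 < c^-1 * h x - 1)%R.
    by rewrite ltrBDr addNr mulr_gt0 ?invr_gt0 ?h0.
  rewrite addrC subrK lnM ?posrE ?invr_gt0 ?h0// lnV ?posrE//; lra.
rewrite (le_trans (y := expeR (t^-1%:E * (c^-1 * i + (ln c - 1) * t)%:E)))//.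
  rewrite lee_expeR lee_pmul2l ?lte_fin ?invr_gt0//.
  apply: (le_trans le1); rewrite integralD//=; last 2 first.
    exact: integrableZl.
    exact: kint.
  by rewrite integralZl// iE integral_cst// muD -!EFinM -EFinD.
rewrite -EFinM /= -EFinD lee_fin -/c.
have -> : (t^-1 * (c^-1 * i + (ln c - 1) * t) = ln c + (c^-1 * (t^-1 * i) - 1))%R.
  by field; rewrite !gt_eqF.
rewrite expRD lnK ?posrE// ler_piMr//; first exact: ltW.
rewrite -[leRHS]expR0 ler_expR subr_le0 mulrC.
by rewrite ler_pdivrMr// mul1r /c lerDl ltW.
Qed.

End integral_complements.

(** * Two integrals on the half-line *)

Section real_integrals.
Context {R : realType}.

Lemma powRN_cvg0 (k : R) : 0 < k -> x `^ (- k) @[x --> +oo] --> 0.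
Proof.
move=> k0; apply/cvgr0Pnorm_le => e e0; near=> x.
have x0 : 0 < x by near: x; exact: nbhs_pinfty_gt.
rewrite ger0_norm ?powR_ge0// powRN invf_ple ?posrE ?powR_gt0//.
have -> : e^-1 = (e^-1 `^ k^-1) `^ k.
  by rewrite -powRrM mulVf ?gt_eqF// powRr1// invr_ge0 ltW.
apply: ge0_ler_powR; rewrite ?nnegrE ?powR_ge0 ?(ltW k0) ?(ltW x0)//.
Unshelve. all: by end_near. Qed.

Lemma integral_powRN (k t : R) : 0 < k -> 0 < t ->
  (\int[lebesgue_measure]_(x in `[t, +oo[) (x `^ (- k - 1))%:E =
   (t `^ (- k) / k)%:E)%E.
Proof.
move=> k0 t0.
have dF (x : R) : 0 < x -> is_derive x 1 (fun x => - (k^-1 * x `^ (- k))) (x `^ (- k - 1)).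
  move=> x0; have d1 := @is_derive1_powR R (- k) x x0.
  have : is_derive x 1 (- (k^-1 *: (fun y : R => y `^ (- k) : R^o))) (- (k^-1 *: (- k * x `^ (- k - 1)))).
    exact: is_deriveN.
  move=> D; apply: (is_derive_eq D).
  by rewrite /GRing.scale/= mulNr mulrN opprK mulrA mulVf ?gt_eqF// mul1r.
have cf (x : R) : 0 < x -> {for x, continuous (fun x => x `^ (- k - 1))}.
  move=> x0; apply: differentiable_continuous; apply/derivable1_diffP.
  by have [] := @is_derive1_powR R (- k - 1) x x0.
rewrite (@ge0_continuous_FTC2y _ _ (fun x => - (k^-1 * x `^ (- k))) _ 0).
- by rewrite add0e mulrC -EFinN opprK.
- by move=> x _; exact: powR_ge0.
- apply: continuous_in_subspaceT => x; rewrite inE/= in_itv/= andbT => tx.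
  by apply: cf; exact: lt_le_trans tx.
- rewrite -[X in _ --> X]oppr0; apply: cvgN; rewrite -(mulr0 k^-1).
  by apply: cvgMr; exact: powRN_cvg0.
- by move=> x tx; have [] := dF x (lt_trans t0 tx).
- have cF : {for t, continuous (fun x : R => - (k^-1 * x `^ (- k)))}.
    apply: differentiable_continuous; apply/derivable1_diffP.
    by have [] := dF t t0.
  exact: cvg_at_right_filter cF.
- move=> x; rewrite in_itv/= andbT => tx; rewrite derive1E.
  exact: (@derive_val _ _ _ _ _ _ _ (dF x (lt_trans t0 tx))).
Qed.

Lemma integral_expRN :
  (\int[lebesgue_measure]_(x in `[0%R, +oo[) (expR (- x))%:E = 1 :> \bar R)%E.
Proof.
rewrite -(@integral_exponential_pdf R 1 ltr01) [LHS]integral_mkcond.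
apply: eq_integral => x _; rewrite /exponential_pdf !patchE; case: ifPn => //= _.
by rewrite mul1r mulN1r.
Qed.

End real_integrals.

(** * Images and restrictions of measures *)

Section measurable_complements.
Context d (T : measurableType d) (R : realType).

Lemma measurable_set_le (f g : T -> R) :
  measurable_fun setT f -> measurable_fun setT g ->
  measurable [set x | f x <= g x].
Proof.
move=> mf mg; rewrite [X in measurable X](_ : _ = (fun x => f x <= g x) @^-1` [set true]).
  by rewrite -[X in measurable X]setTI; apply: (measurable_fun_ler mf mg).
by apply/seteqP; split => x /=; case: (_ <= _).
Qed.

Lemma measurable_set_lt (f g : T -> R) :
  measurable_fun setT f -> measurable_fun setT g ->
  measurable [set x | f x < g x].
Proof.
move=> mf mg; rewrite [X in measurable X](_ : _ = (fun x => f x < g x) @^-1` [set true]).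
  by rewrite -[X in measurable X]setTI; apply: (measurable_fun_ltr mf mg).
by apply/seteqP; split => x /=; case: (_ < _).
Qed.

End measurable_complements.

Section image_measure.
Context d d' (T : measurableType d) (T' : measurableType d') (R : realType).

(** A bundled measure that carries the measurability of f. *)
Definition image_measure (m : {measure set T -> \bar R}) (f : T -> T')
    (mf : measurable_fun setT f) : {measure set T' -> \bar R} :=
  measure_function_pushforward__canonical__measure_function_Measure m mf.

Lemma image_measureE m f mf (A : set T') : @image_measure m f mf A = m (f @^-1` A).
Proof. by []. Qed.

Lemma ge0_integral_image m f mf (D : set T') (h : T' -> \bar R) :
  measurable D -> measurable_fun D h -> (forall y, D y -> (0 <= h y)%E) ->
  (\int[@image_measure m f mf]_(y in D) h y = \int[m]_(x in f @^-1` D) h (f x))%E.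
Proof.
move=> mD mh h0; apply: (@ge0_integral_pushforward _ _ _ _ _ f mf m D h) => // y /set_mem; exact: h0.
Qed.

End image_measure.

(** * Functions b with {0 < b <= t} of measure t *)

Section volume.
Local Open Scope ereal_scope.
Context d (X : measurableType d) (R : realType).
Variable mu : {measure set X -> \bar R}.
Variable b : X -> R.
Hypothesis mb : measurable_fun setT b.

Definition pos_set : set X := [set x | (0 < b x)%R].
(** The centre, where b = 0, is left out because the tilde weights vanish
there. *)
Definition sublevel (t : R) : set X := [set x | (0 < b x)%R /\ (b x <= t)%R].

Hypothesis mub : forall t : R, (0 <= t)%R -> mu (sublevel t) = t%:E.

Lemma measurable_pos_set : measurable pos_set.
Proof. by apply: measurable_set_lt. Qed.

Lemma measurable_sublevel t : measurable (sublevel t).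
Proof.
by apply: measurableI; [exact: measurable_pos_set|exact: measurable_set_le].
Qed.

(** The image of mu under b agrees with Lebesgue measure on the half-line,
because both have the same mass on intervals; Lebesgue measure on the negative
half-line is added to get a comparison on all of the real line. *)
Lemma pushforward_volume (A : set R) : measurable A -> A `<=` [set t | (0 < t)%R] ->
  mu (b @^-1` A) = lebesgue_measure A.
Proof.
move=> mA A0.
have mN : measurable (`]-oo, 0%R]%classic : set (measurableTypeR R)).
  exact: measurable_itv.
have mb' : measurable_fun setT (b : X -> measurableTypeR R) by [].
pose m : {measure set (measurableTypeR R) -> \bar R} :=
  measure_add (image_measure (mrestr mu measurable_pos_set) mb')
  (mrestr (@lebesgue_measure R) mN).
have mE B : m B = mu (b @^-1` B `&` pos_set) + lebesgue_measure (B `&` `]-oo, 0%R]).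
  exact: measure_addE.
have -> : lebesgue_measure A = m A.
  apply: (@lebesgue_measure_unique R m) => // _ [[x y]] _ <-.
  rewrite mE /= lebesgue_measure_itv/= lte_fin.
  have [xy|yx] := ltP x y; last first.
    rewrite set_itv_ge ?bnd_simp -?leNgt//.
    by rewrite preimage_set0 !set0I !measure0 adde0.
  have [y0|y0] := leP y 0%R.
    rewrite [X in mu X](_ : _ = set0) ?measure0 ?add0e; last first.
      apply/seteqP; split => // z [/=]; rewrite /pos_set in_itv/= => /andP[_ zy] /= z0.
      by have := lt_le_trans z0 (le_trans zy y0); rewrite ltxx.
    rewrite [X in lebesgue_measure X](_ : _ = `]x, y]%classic).
      by rewrite lebesgue_measure_itv/= lte_fin xy.
    apply/seteqP; split => z /=; first by case.
    by rewrite !in_itv/= => /andP[xz zy]; split; [rewrite xz|rewrite (le_trans zy)].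
  have [x0|x0] := leP 0%R x.
    rewrite [X in lebesgue_measure X](_ : _ = set0) ?measure0 ?adde0; last first.
      apply/seteqP; split => // z [/=]; rewrite !in_itv/= => /andP[xz _] z0.
      by have := lt_le_trans xz (le_trans z0 x0); rewrite ltxx.
    rewrite [X in mu X](_ : _ = sublevel y `\` sublevel x); last first.
      apply/seteqP; split => z /=; rewrite /sublevel /pos_set/= in_itv/=.
        move=> [/andP[xz zy] z0]; split => // -[_]; rewrite leNgt xz //.
      move=> [[z0 zy] nz]; split => //; rewrite zy andbT ltNge; apply/negP => zx.
      exact: nz.
    have muy : mu (sublevel y) < +oo by rewrite mub ?ltry// ltW.
    rewrite (measureD (measurable_sublevel y) (measurable_sublevel x) muy).
    rewrite (_ : sublevel y `&` sublevel x = sublevel x); last first.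
      apply/seteqP; split => z /=; rewrite /sublevel /=; first by case.
      by move=> [z0 zx]; split => //; split => //; rewrite (le_trans zx)// ltW.
    rewrite EFinN; congr (_ - _); apply: esym; last exact: mub.
    exact: (mub (ltW (le_lt_trans x0 xy))).
  rewrite [X in mu X](_ : _ = sublevel y); last first.
    apply/seteqP; split => z /=; rewrite /sublevel /pos_set/= in_itv/=.
      by move=> [/andP[xz zy] z0].
    by move=> [z0 zy]; rewrite zy z0 (lt_trans x0).
  rewrite mub ?ltW// [X in lebesgue_measure X](_ : _ = `]x, 0%R]%classic); last first.
    apply/seteqP; split => z /=; rewrite !in_itv/=.
      by move=> [/andP[-> _] ->].
    by move=> /andP[-> z0]; split => //=; rewrite (le_trans z0)// ltW.
  by rewrite lebesgue_measure_itv/= lte_fin x0 add0e.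
rewrite mE [X in lebesgue_measure X](_ : _ = set0) ?measure0 ?adde0.
  congr (mu _); apply/seteqP; split => [x Ax|x []//].
  by split => //; exact: A0.
apply/seteqP; split => // z [/= /A0 /= z0]; rewrite in_itv/= => /(lt_le_trans z0).
by rewrite ltxx.
Qed.

Lemma volume_sphere (t : R) : (0 < t)%R -> mu [set x | b x = t] = 0.
Proof.
move=> t0; rewrite -(@lebesgue_measure_set1 R t) -pushforward_volume//.
by move=> _ ->.
Qed.

End volume.

Section integral_mrestr.
Local Open Scope ereal_scope.
Context d (X : measurableType d) (R : realType).
Variable mu : {measure set X -> \bar R}.

Lemma ge0_integral_mrestr (C D : set X) (mC : measurable C) (h : X -> \bar R) :
  measurable D -> measurable_fun D h -> (forall x, D x -> 0 <= h x) ->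
  \int[mrestr mu mC]_(x in D) h x = \int[mu]_(x in C `&` D) h x.
Proof.
move=> mD mh h0; have mDC := measurableI _ _ mD mC; have mDnC := measurableD mD mC.
rewrite -{1}(setUIDK D C) (@ge0_integral_setU _ _ _ (mrestr mu mC))//; last 3 first.
- by rewrite setUIDK.
- by move=> x; rewrite setUIDK; exact: h0.
- by apply/disj_setPS => x [[_ Cx] [_ /(_ Cx)]].
rewrite [X in _ + X]null_set_integral//.
- rewrite adde0 setIC; apply: eq_measure_integral => A mA AC.
  by rewrite /= /mrestr setIidl// => x /AC [].
- exact: measurable_funS mh.
- rewrite /= /mrestr (_ : _ `&` C = set0) ?measure0//.
  by apply/seteqP; split => // x [[_ nC] /nC].
Qed.

End integral_mrestr.

Section cone.
Local Open Scope ereal_scope.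
Context d (X : measurableType d) (R : realType).
Variable mu : {measure set X -> \bar R}.
Variable b : X -> R.
Hypothesis mb : measurable_fun setT b.
Variables (C : set X) (c : R).
Hypotheses (mC : measurable C) (c0 : (0 <= c)%R).
Hypothesis muC : forall t : R, (0 <= t)%R -> mu (C `&` sublevel b t) = (c * t)%:E.

(** On a cone the image of mu under b is a multiple of Lebesgue measure:
rescale the restriction of mu to the cone unless the multiple is zero. *)
Lemma cone_measure (A : set R) : measurable A -> A `<=` [set t | (0 < t)%R] ->
  mu (C `&` b @^-1` A) = c%:E * lebesgue_measure A.
Proof.
move=> mA A0.
have mbA : measurable (b @^-1` A) by rewrite -[X in measurable X]setTI; exact: mb.
have [cE|cn0] := eqVneq c 0%R.
  rewrite cE mul0e; apply/eqP; rewrite eq_le measure_ge0 andbT.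
  have sub : C `&` b @^-1` A `<=` \bigcup_(n : nat) (C `&` sublevel b n%:R).
    move=> x [Cx bA]; have bx0 : (0 < b x)%R := A0 _ bA.
    exists (Num.bound (b x)) => //; split => //; split => //.
    by rewrite ltW// archi_boundP// ltW.
  have mCb n : measurable (C `&` sublevel b n%:R).
    by apply: measurableI => //; exact: measurable_sublevel.
  apply: (le_trans (measure_sigma_subadditive mu mCb _ sub)).
    exact: measurableI.
  by rewrite eseries0// => n _ _ /=; rewrite muC// cE mul0r.
have ci0 : (0 <= c^-1)%R by rewrite invr_ge0.
have h t : (0 <= t)%R -> mscale (NngNum ci0) (mrestr mu mC) (sublevel b t) = t%:E.
  by move=> t0; rewrite /= /mscale/= /mrestr setIC muC// -EFinM mulrA mulVf// mul1r.
rewrite -(@pushforward_volume _ X R _ b mb h A mA A0) /= /mscale/= /mrestr muleA -EFinM mulfV//.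
by rewrite mul1e setIC.
Qed.

Lemma ge0_integral_cone (D : set R) (phi : R -> \bar R) :
  measurable D -> D `<=` [set t | (0 < t)%R] -> measurable_fun D phi ->
  (forall t, D t -> 0 <= phi t) ->
  \int[mu]_(x in C `&` b @^-1` D) phi (b x) =
  c%:E * \int[lebesgue_measure]_(t in D) phi t.
Proof.
move=> mD D0 mphi phi0.
have mb' : measurable_fun setT (b : X -> measurableTypeR R) by [].
have mbD : measurable (b @^-1` D) by rewrite -[X in measurable X]setTI; exact: mb.
rewrite -(@ge0_integral_mrestr _ _ _ mu C _ mC)//; last 2 first.
- apply: (measurable_comp mD) => //; first by move=> _ [x Dx <-].
  exact: measurable_funTS.
- by move=> x; exact: phi0.
rewrite -(ge0_integral_image _ mb' mD mphi phi0).
rewrite -(@ge0_integral_mscale _ _ _ (@lebesgue_measure R) D mD (NngNum c0) phi mphi phi0).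
apply: eq_measure_integral => A mA AD.
by rewrite image_measureE /= /mrestr setIC (cone_measure mA (subset_trans AD D0)).
Qed.

Lemma integral_cone_powRN (k t : R) : (0 < k)%R -> (0 < t)%R ->
  \int[mu]_(x in C `&` [set x | (t <= b x)%R]) (b x `^ (- k - 1))%:E =
  (c * (t `^ (- k) / k))%:E.
Proof.
move=> k0 t0.
rewrite (_ : [set x | (t <= b x)%R] = b @^-1` `[t, +oo[); last first.
  by apply/seteqP; split => x /=; rewrite in_itv/= andbT.
rewrite (@ge0_integral_cone _ (fun t => (t `^ (- k - 1))%:E)) ?integral_powRN ?EFinM//.
- by move=> s /=; rewrite in_itv/= andbT => /(lt_le_trans t0).
- by apply/measurable_EFinP; apply: measurable_funTS.
- by move=> s _; rewrite lee_fin powR_ge0.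
Qed.

End cone.

Section integral_volume.
Local Open Scope ereal_scope.
Context d (X : measurableType d) (R : realType).
Variable mu : {measure set X -> \bar R}.
Variable b : X -> R.
Hypothesis mb : measurable_fun setT b.
Hypothesis mub : forall t : R, (0 <= t)%R -> mu (sublevel b t) = t%:E.

Lemma integral_volume_powRN (k t : R) : (0 < k)%R -> (0 < t)%R ->
  \int[mu]_(x in [set x | (t <= b x)%R]) (b x `^ (- k - 1))%:E = (t `^ (- k) / k)%:E.
Proof.
move=> k0 t0; rewrite -[LHS]/(\int[mu]_(x in [set x | (t <= b x)%R]) _) -(setTI [set x | _]).
rewrite (@integral_cone_powRN _ _ _ mu b mb setT 1%R measurableT ler01) ?mul1r//.
by move=> s s0; rewrite setTI mul1r mub.
Qed.

End integral_volume.

Section volume_sigma_finite.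
Local Open Scope ereal_scope.
Context d (X : measurableType d) (R : realType).
Variable mu : {sigma_finite_measure set X -> \bar R}.
Variable b : X -> R.
Hypothesis mb : measurable_fun setT b.
Hypothesis mub : forall t : R, (0 <= t)%R -> mu (sublevel b t) = t%:E.

Local Notation sublevel := (sublevel b).

Let mu_sublevel t : (0 <= t)%R -> (mu : {measure set X -> \bar R}) (sublevel t) = t%:E.
Proof. exact: mub. Qed.

Let msublevel t : measurable (sublevel t).
Proof. exact: measurable_sublevel. Qed.

(** Layer cake: log (t / b) is the length of the interval of those s >= 0 with
b <= t exp(-s). Exchanging the integrals leaves the integral of t exp(-s) over
s >= 0. *)
Lemma integral_volume_ln_ratio (t : R) : (0 < t)%R ->
  \int[mu]_(x in sublevel t) (ln (t / b x))%:E = t%:E.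
Proof.
move=> t0.
pose A : set (X * R) := [set z | (0 < b z.1)%R /\ (0 <= z.2)%R /\
   (b z.1 <= t * expR (- z.2))%R].
have mb1 : measurable_fun setT (fun z : X * R => b z.1).
  exact: (measurableT_comp mb measurable_fst).
have mA : measurable A.
  apply: measurableI; first exact: measurable_set_lt.
  apply: measurableI; first exact: measurable_set_le.
  apply: measurable_set_le => //; apply: measurable_funM => //.
  apply: (measurableT_comp (@measurable_expR R)).
  by apply: measurable_funN; exact: measurable_snd.
have E : \int[mu]_x \int[lebesgue_measure]_s (\1_A (x, s))%:E =
    \int[lebesgue_measure]_s \int[mu]_x (\1_A (x, s))%:E.
  apply: (@fubini_tonelli _ _ X (measurableTypeR R) R mu lebesgue_measure
    (fun z => (\1_A z)%:E)).
  - by apply/measurable_EFinP; exact: measurable_indic.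
  - by move=> z; rewrite lee_fin.
transitivity (\int[mu]_x \int[lebesgue_measure]_s (\1_A (x, s))%:E).
  rewrite integral_mkcond; apply: eq_integral => x _; rewrite patchE.
  have sE : (fun s : R => (\1_A (x, s))%:E) = (EFin \o \1_[set s | A (x, s)]).
    by [].
  have mAx : measurable [set s : R | A (x, s)].
    have := @measurable_xsection _ _ X (measurableTypeR R) A x mA.
    by rewrite xsectionE.
  rewrite sE integral_indic// setIT.
  case: ifPn => [/set_mem|/negP bx] /=.
    move=> [bx0 bxt]; rewrite (_ : [set s | _] = `[0%R, ln (t / b x)]%classic).
      rewrite lebesgue_measure_itv/= lte_fin; case: ltP => [_|].
        by rewrite sube0.
      by move=> l0; congr EFin; apply/eqP; rewrite eq_le l0 ln_ge0// ler_pdivlMr// mul1r.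
    apply/seteqP; split => s /=; rewrite in_itv/=.
      move=> [_ [-> /= bs]]; rewrite -ler_expR lnK ?posrE ?divr_gt0//.
      by rewrite ler_pdivlMr// -ler_pdivlMl ?expR_gt0// -expRN mulrC.
    move=> /andP[s0 sl]; split => //; split => //.
    rewrite expRN ler_pdivlMr ?expR_gt0// mulrC -ler_pdivlMr//.
    by rewrite -[leRHS](@lnK R) ?posrE ?divr_gt0// ler_expR.
  rewrite (_ : [set s | _] = set0) ?measure0//; apply/seteqP; split => // s [/= b0 [s0 bs]].
  apply: bx; rewrite inE; split => //=; apply: (le_trans bs).
  by rewrite ler_piMr ?(ltW t0)// -[leRHS]expR0 ler_expR oppr_le0.
rewrite E; transitivity (\int[lebesgue_measure]_(s in `[0%R, +oo[) (t%:E * (expR (- s))%:E)).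
  rewrite [RHS]integral_mkcond; apply: eq_integral => s _; rewrite patchE.
  have sE : (fun x => (\1_A (x, s))%:E) = (EFin \o \1_[set x | A (x, s)]).
    by [].
  have mAs : measurable [set x | A (x, s)].
    have := @measurable_ysection _ _ X (measurableTypeR R) A s mA.
    by rewrite ysectionE.
  rewrite sE integral_indic// setIT; case: ifPn => [|/negP].
    rewrite inE/= in_itv/= andbT => s0; rewrite -EFinM -mub ?mulr_ge0 ?expR_ge0 ?(ltW t0)//.
    congr (mu _); apply/seteqP; split => x /=; first by case=> ? [].
    by case.
  rewrite inE/= in_itv/= andbT => s0; rewrite (_ : [set x | _] = set0) ?measure0//.
  by apply/seteqP; split => // x [/= _ [/s0]].
rewrite ge0_integralZl//=.
- by rewrite integral_expRN mule1.
- apply/measurable_EFinP; apply: (measurableT_comp (@measurable_expR R)) => //.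
- by rewrite lee_fin ltW.
Qed.

Lemma integrable_sublevel_cst (t c : R) : (0 < t)%R ->
  mu.-integrable (sublevel t) (EFin \o cst c).
Proof.
move=> t0; apply/integrableP; split; first exact/measurable_EFinP.
rewrite /= integral_cst; last exact: msublevel.
by rewrite mu_sublevel ?(ltW t0)// -EFinM ltry.
Qed.

(** This average of log b over the ball is where the factor e^(q/p) of the
constant comes from. *)
Lemma integral_volume_ln (t : R) : (0 < t)%R ->
  mu.-integrable (sublevel t) (fun x => (ln (b x))%:E) /\
  \int[mu]_(x in sublevel t) (ln (b x))%:E = (t * ln t - t)%:E.
Proof.
move=> t0; have mbt := msublevel t.
have ml : measurable_fun setT (fun x => ln (b x)) by exact: measurableT_comp.
have lnE x : x \in sublevel t -> (ln (t / b x))%:E = (ln t)%:E - (ln (b x))%:E.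
  by move=> /set_mem[bx0 _]; rewrite ln_div ?posrE.
have i1 : mu.-integrable (sublevel t) (fun x => (ln t - ln (b x))%:E).
  apply/integrableP; split.
    apply/measurable_EFinP; apply: measurable_funTS; exact: measurable_funB.
  rewrite (eq_integral (fun x => (ln (t / b x))%:E)) ?integral_volume_ln_ratio ?ltry//.
  move=> x xt; rewrite lnE// -EFinB /=; congr EFin; apply: ger0_norm.
  by move: xt => /set_mem[bx0 bxt]; rewrite subr_ge0 ler_ln.
have i2 := integrable_sublevel_cst (ln t) t0.
have lnbE x : (ln (b x))%:E = (ln t)%:E - (ln t - ln (b x))%:E.
  by rewrite -EFinB opprB addrC subrK.
split.
  rewrite (_ : (fun x => _) = (EFin \o cst (ln t)) \- (fun x => (ln t - ln (b x))%:E)).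
    exact: integrableB.
  by apply/funext => x; rewrite lnbE.
under eq_integral do rewrite lnbE.
rewrite integralB_EFin// integral_cst//.
rewrite (eq_integral (fun x => (ln (t / b x))%:E)) ?integral_volume_ln_ratio//.
  by rewrite mu_sublevel ?(ltW t0)// -EFinM -EFinB mulrC.
by move=> x xt; rewrite lnE.
Qed.

End volume_sigma_finite.

(** * Measures determined by cones, and images of weighted measures *)

Section polar_uniqueness.
Local Open Scope ereal_scope.
Context d (X : measurableType d) (R : realType).
Variables (m1 m2 : {measure set X -> \bar R}).
Variables (b : X -> R) (dir : X -> X) (point : R * X -> X) (c : set X -> R).
Hypotheses (mb : measurable_fun setT b) (mdir : measurable_fun setT dir)
  (mpoint : measurable_fun setT point).
Hypothesis pointK : forall x, (0 < b x)%R -> point (b x, dir x) = x.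
Hypothesis c0 : forall E, (0 <= c E)%R.
Hypothesis m1E : forall E t, measurable E -> (0 <= t)%R ->
  m1 (dir @^-1` E `&` sublevel b t) = (c E * t)%:E.
Hypothesis m2E : forall E t, measurable E -> (0 <= t)%R ->
  m2 (dir @^-1` E `&` sublevel b t) = (c E * t)%:E.

(** Rectangles generate the product sigma-algebra and are stable under
intersection, and the pair (b, dir) has a measurable inverse on the set where b
is positive; so the values on cones determine the measure there. *)
Lemma polar_measure_unique (A : set X) : measurable A -> A `<=` pos_set b -> m1 A = m2 A.
Proof.
move=> mA Ab.
have mbp := measurable_pos_set mb.
pose P (x : X) : R * X := (b x, dir x).
have mP : measurable_fun setT P by exact: measurable_fun_pair.
pose n1 := image_measure (mrestr m1 mbp) mP.
pose n2 := image_measure (mrestr m2 mbp) mP.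
have mdirE E : measurable E -> measurable (dir @^-1` E).
  by move=> mE; rewrite -[X in measurable X]setTI; exact: mdir.
have rect (m : {measure set X -> \bar R}) (B : set R) E : measurable B -> measurable E ->
    (forall E t, measurable E -> (0 <= t)%R ->
      m (dir @^-1` E `&` sublevel b t) = (c E * t)%:E) ->
    m (P @^-1` (B `*` E) `&` pos_set b) =
    (c E)%:E * lebesgue_measure (B `&` [set t | (0 < t)%R]).
  move=> mB mE mH.
  rewrite -(@cone_measure _ X R m b mb (dir @^-1` E) (c E) (mdirE _ mE) (c0 E))//.
  - by congr (m _); apply/seteqP; split => x /=; rewrite /P/= /pos_set /=; tauto.
  - by move=> t; exact: mH.
  - by apply: measurableI => //; exact: measurable_set_lt.
have n1E B : n1 B = m1 (P @^-1` B `&` pos_set b) by [].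
have n2E B : n2 B = m2 (P @^-1` B `&` pos_set b) by [].
suff : n1 (point @^-1` A) = n2 (point @^-1` A).
  have pA : P @^-1` (point @^-1` A) `&` pos_set b = A.
    apply/seteqP; split => x /=; first by case=> + bx; rewrite pointK.
    by move=> Ax; have bx := Ab _ Ax; split => //; rewrite pointK.
  by rewrite n1E n2E pA.
pose G : set (set (R * X)) :=
  [set B | exists A, measurable A /\ exists E, measurable E /\ B = A `*` E].
apply: (measure_unique G (fun n => [set t : R | (t <= n%:R)%R] `*` setT)).
- rewrite measurable_prod_measurableType //; congr (<<s _ >>).
  rewrite predeqE; split => [[B mB [E mE <-]]|[B [mB [E [mE ->]]]]].
    by exists B; split => //; exists E.
  by exists B => //; exists E.
- move=> /= _ _ [X1 [mX1 [X2 [mX2 ->]]]] [Y1 [mY1 [Y2 [mY2 ->]]]].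
  rewrite -setXI; exists (X1 `&` Y1); split; first exact: measurableI.
  by exists (X2 `&` Y2); split => //; exact: measurableI.
- by move=> n; exists [set t : R | (t <= n%:R)%R]; split; [exact: measurable_set_le|exists setT].
- apply/seteqP; split => // -[t x] _; exists (Num.bound `|t|%R) => //; split => //=.
  by apply: le_trans (ler_norm t) (ltW (archi_boundP (normr_ge0 t))).
- move=> _ [B [mB [E [mE ->]]]]; by rewrite n1E n2E (rect m1)// (rect m2).
- move=> n; rewrite n1E (rect m1)//; last exact: measurable_set_le.
  rewrite (_ : _ `&` _ = `]0%R, n%:R]%classic); last first.
    apply/seteqP; split => t /=; rewrite in_itv/=; first by case=> -> ->.
    by move=> /andP[-> ->].
  by rewrite lebesgue_measure_itv/= lte_fin; case: ifPn; rewrite ?sube0 -?EFinM ?mule0 ltry.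
- by rewrite -[X in measurable X]setTI; exact: mpoint.
Qed.

End polar_uniqueness.

Section weighted_image.
Local Open Scope ereal_scope.
Context d d' (T : measurableType d) (T' : measurableType d') (R : realType).
Variables (m : {sigma_finite_measure set T -> \bar R}) (J : T -> R) (phi : T -> T').
Hypotheses (mJ : measurable_fun setT J) (J0 : forall x, (0 <= J x)%R)
  (mphi : measurable_fun setT phi).

Let H : set (T * R) := [set z | (0 <= z.2)%R /\ (z.2 < J z.1)%R].

Let mH : measurable H.
Proof.
apply: measurableI; first by apply: measurable_set_le => //; exact: measurable_snd.
apply: measurable_set_lt; first exact: measurable_snd.
exact: (measurableT_comp mJ measurable_fst).
Qed.

Let mphi1 : measurable_fun setT (phi \o fst : T * measurableTypeR R -> T').
Proof. exact: (measurableT_comp mphi measurable_fst). Qed.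

(** The image under phi of the measure with density J. Instead of a density,
the restriction of m times Lebesgue measure to the region below the graph of J
is pushed forward. *)
Definition weighted_image : {measure set T' -> \bar R} :=
  image_measure (mrestr (m \x @lebesgue_measure R) mH) mphi1.

Lemma ge0_integral_weighted_image (h : T' -> \bar R) :
  measurable_fun setT h -> (forall y, 0 <= h y) ->
  \int[weighted_image]_y h y = \int[m]_x (h (phi x) * (J x)%:E).
Proof.
move=> mh h0; rewrite ge0_integral_image//.
have mhp : measurable_fun setT (fun z : T * R => h (phi z.1)).
  exact: (measurableT_comp mh mphi1).
rewrite preimage_setT (@ge0_integral_mrestr _ _ _ (m \x lebesgue_measure) H _ mH)//.
rewrite setIT integral_mkcond fubini_tonelli1//; last 2 first.
- apply: (proj1 (measurable_restrictT _ mH)).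
  exact: measurable_funS measurableT (@subsetT _ _) mhp.
- by move=> z; rewrite patchE; case: ifPn.
apply: eq_integral => x _; rewrite /fubini_F.
transitivity (\int[lebesgue_measure]_(y in `[0%R, J x[) h (phi x)).
  rewrite [RHS]integral_mkcond; apply: eq_integral => y _; rewrite !patchE.
  have -> // : ((x, y) \in H) = (y \in `[0%R, J x[%classic).
  apply/idP/idP => /set_mem hh; apply/mem_set; move: hh.
    by case=> /= y0 yJ; rewrite in_itv/= y0.
  by rewrite /H/= in_itv/= => /andP[].
rewrite integral_cst//= lebesgue_measure_itv/= lte_fin; case: ltP => [_|J0'].
  by rewrite sube0.
by rewrite mule0 (_ : J x = 0%R) ?mule0//; apply/eqP; rewrite eq_le J0' J0.
Qed.

Lemma weighted_imageE (A : set T') : measurable A ->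
  weighted_image A = \int[m]_(x in phi @^-1` A) (J x)%:E.
Proof.
move=> mA; rewrite -(setIT A) -integral_indic// setIT.
rewrite (@ge0_integral_weighted_image (fun y => (\1_A y)%:E))//; last first.
  by apply/measurable_EFinP; exact: measurable_indic.
rewrite [RHS]integral_mkcond; apply: eq_integral => x _; rewrite patchE indicE.
have -> : (x \in phi @^-1` A) = (phi x \in A) by apply/idP/idP; rewrite !inE.
by case: ifPn => _; rewrite ?mul1e ?mul0e.
Qed.

End weighted_image.

(** * The inequality for geometric means on a measure space *)

Section log_integrals.
Local Open Scope ereal_scope.
Context d (T : measurableType d) (R : realType).
Variable mu : {measure set T -> \bar R}.

(** If the negative part of log f and f^p v are integrable, then log v <= f^p v
- p log f shows that the negative part of log (1/v) is integrable. A finite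
bound on its integral then makes log (1/v) integrable, and p log f <= f^p v +
log (1/v) does the same for log f. *)
Lemma integrable_ln_weighted (D : set T) (f v : T -> R) (p : R) :
  measurable D -> measurable_fun D f -> measurable_fun D v -> (0 < p)%R ->
  (forall x, D x -> (0 < f x)%R) -> (forall x, D x -> (0 < v x)%R) ->
  -oo < \int[mu]_(x in D) (ln (f x))%:E ->
  \int[mu]_(x in D) (f x `^ p * v x)%:E < +oo ->
  \int[mu]_(x in D) (ln (v x)^-1)%:E < +oo ->
  mu.-integrable D (fun x => (ln (f x))%:E) /\
  mu.-integrable D (fun x => (ln (v x)^-1)%:E).
Proof.
move=> mD mf mv p0 f0 v0 If Ig Iv.
have mlf : measurable_fun D (fun x => ln (f x)) by exact: measurableT_comp.
have mlv : measurable_fun D (fun x => ln (v x)^-1).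
  apply: (eq_measurable_fun (fun x => - ln (v x))%R).
    by move=> x /set_mem Dx; rewrite lnV ?posrE ?v0.
  by apply: measurable_funN; exact: measurableT_comp.
have mg : measurable_fun D (fun x => f x `^ p * v x)%R.
  apply: measurable_funM => //.
  exact: (measurableT_comp (measurable_powR _)).
have lnE x : D x -> (p * ln (f x) <= f x `^ p * v x + ln (v x)^-1)%R.
  move=> Dx; have g0 : (0 < f x `^ p * v x)%R by rewrite mulr_gt0 ?powR_gt0 ?f0 ?v0.
  have := ltW (ln_sublinear g0).
  rewrite lnM ?posrE ?powR_gt0 ?f0 ?v0// ln_powR lnV ?posrE ?v0//; lra.
have Fn := integral_neg_lty If.
have bound (a c : R) (h h1 h2 : T -> \bar R) : (0 <= a)%R -> (0 <= c)%R ->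
    measurable_fun D h1 -> measurable_fun D h2 ->
    (forall x, 0 <= h1 x) -> (forall x, D x -> 0 <= h2 x) ->
    (forall x, D x -> h x <= a%:E * h1 x + c%:E * h2 x) ->
    \int[mu]_(x in D) h1 x < +oo -> \int[mu]_(x in D) h2 x < +oo ->
    \int[mu]_(x in D) h x < +oo.
  move=> a0 c0 mh1 mh2 h10 h20 hle I1 I2; apply: (le_lt_trans (integral_mono _ hle)).
  rewrite ge0_integralD//; last 4 first.
  - by move=> x _; rewrite mule_ge0.
  - exact: measurable_funeM.
  - by move=> x Dx; rewrite mule_ge0 ?h20.
  - exact: measurable_funeM.
  rewrite !ge0_integralZl//.
  by apply: lte_add_pinfty; apply: lte_mul_pinfty => //; exact: integral_ge0.
have mEf : measurable_fun D (EFin \o (fun x => ln (f x))) by exact/measurable_EFinP.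
have mEv : measurable_fun D (EFin \o (fun x => ln (v x)^-1)) by exact/measurable_EFinP.
have mEg : measurable_fun D (fun x => (f x `^ p * v x)%:E) by exact/measurable_EFinP.
have g0 x : D x -> 0 <= (f x `^ p * v x)%:E.
  by move=> Dx; rewrite lee_fin mulr_ge0 ?powR_ge0 ?ltW ?v0.
have iv : mu.-integrable D (EFin \o (fun x => ln (v x)^-1)).
  apply: integral_fin_integrable => //.
  apply: (bound p 1%R _ (EFin \o (fun x => ln (f x)))^\- (fun x => (f x `^ p * v x)%:E)) => //.
    exact: ltW.
    exact: measurable_funeneg.
  move=> x Dx; rewrite mul1e !funerneg /= -EFinM -EFinD lee_fin /funrneg.
  rewrite ge_max; apply/andP; split; last first.
    by rewrite addr_ge0 ?mulr_ge0 ?(ltW p0) ?le_max ?lexx ?orbT// ?powR_ge0 ?ltW ?v0.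
  have : (p * - ln (f x) <= p * Num.max (- ln (f x)) 0)%R.
    by rewrite ler_pM2l// le_max lexx.
  have := lnE _ Dx; lra.
split => //; apply: integrable_posneg => //.
apply: (bound p^-1%R p^-1%R _ (EFin \o (fun x => ln (v x)^-1))^\+ (fun x => (f x `^ p * v x)%:E)) => //.
- by rewrite invr_ge0 ltW.
- by rewrite invr_ge0 ltW.
- exact: measurable_funepos.
- move=> x Dx; rewrite !funerpos /= -!EFinM -EFinD lee_fin /funrpos -mulrDr.
  rewrite ge_max; apply/andP; split; last first.
    rewrite mulr_ge0 ?invr_ge0 ?(ltW p0)// addr_ge0 ?le_max ?lexx ?orbT//.
    by rewrite mulr_ge0 ?powR_ge0 ?ltW ?v0.
  rewrite -ler_pdivrMl ?invr_gt0// invrK addrC (le_trans (lnE _ Dx))// lerD2l.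
  by rewrite le_max lexx.
- exact: integral_funepos_lt_pinfty.
Qed.

End log_integrals.

Section real_bound.
Context {R : realType}.

(** The whole estimate at one point once every integral is finite: w is the
value of u, Lf, Lg and Lv are the means of log f, log (f^p v) and log (1/v),
and the last two hypotheses are Jensen's inequality for g and for g b^(q/p). *)
Lemma pointwise_real_bound (p q t D A w Lf Lg Lv I1 : R) :
  0 < p -> p <= q -> 0 < t -> 0 < D -> 0 <= A -> 0 < w ->
  p * Lf = Lg + Lv ->
  t `^ (q^-1 - p^-1) * w `^ q^-1 * (expR Lv) `^ p^-1 <= D ->
  expR Lg <= t^-1 * A ->
  expR (Lg + (q / p) * (ln t - 1)) <= t^-1 * I1 ->
  (expR Lf) `^ q * w <=
  (D `^ q * expR (q / p) * A `^ (q / p - 1)) * (t `^ (- (q / p) - 1) * I1).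
Proof.
move=> p0 pq t0 D0 A0 w0 LE Dle J1 J2.
have q0 : 0 < q by exact: lt_le_trans pq.
set k := q / p; have k1 : 1 <= k by rewrite ler_pdivlMr// mul1r.
have tE a : t `^ a = expR (a * ln t) by rewrite /powR gt_eqF.
have wE : w `^ q^-1 = expR (q^-1 * ln w) by rewrite /powR gt_eqF.
have eE a b : expR a `^ b = expR (b * a) by rewrite /powR gt_eqF ?expR_gt0// expRK.
have DE : D `^ q = expR (q * ln D) by rewrite /powR gt_eqF.
(* raise the bound by D to the power q and take logarithms *)
have wle : expR (k * Lv) * w <= D `^ q * t `^ (k - 1).
  have wE' : w = expR (ln w) by rewrite lnK.
  move: Dle; rewrite tE wE eE -!expRD -[leRHS]lnK// ler_expR => Dle.
  rewrite [in leLHS]wE' DE tE -!expRD ler_expR.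
  have : q * ((q^-1 - p^-1) * ln t + q^-1 * ln w + p^-1 * Lv) <= q * ln D.
    by rewrite ler_pM2l.
  have -> : q * ((q^-1 - p^-1) * ln t + q^-1 * ln w + p^-1 * Lv) =
    (1 - k) * ln t + ln w + k * Lv by rewrite /k; field; rewrite !gt_eqF.
  lra.
have gle : expR (k * Lg) <=
    expR k * A `^ (k - 1) * t `^ (1 - k) * (t `^ (- k - 1) * I1).
  have -> : expR (k * Lg) = (expR Lg) `^ (k - 1) * expR (k - k * ln t) *
      expR (Lg + k * (ln t - 1)).
    by rewrite eE -!expRD; congr expR; lra.
  have h1 : (expR Lg) `^ (k - 1) <= (t^-1 * A) `^ (k - 1).
    by rewrite ge0_ler_powR ?nnegrE ?subr_ge0 ?expR_ge0 ?mulr_ge0 ?invr_ge0 ?(ltW t0).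
  apply: (le_trans (ler_pM _ _ (ler_wpM2r _ h1) J2)); rewrite ?mulr_ge0 ?powR_ge0 ?expR_ge0//.
  have tVE : t^-1 = expR (- ln t) by rewrite expRN lnK.
  rewrite powRM ?invr_ge0 ?(ltW t0)// tVE eE !tE le_eqVlt; apply/orP; left; apply/eqP.
  have e1 : expR ((k - 1) * - ln t) * expR (k - k * ln t) * expR (- ln t) =
      expR k * expR ((1 - k) * ln t) * expR ((- k - 1) * ln t).
    by rewrite -!expRD; congr expR; lra.
  transitivity (expR ((k - 1) * - ln t) * expR (k - k * ln t) * expR (- ln t) *
    (A `^ (k - 1) * I1)); first by ring.
  by rewrite e1; ring.
have -> : (expR Lf) `^ q * w = expR (k * Lg) * (expR (k * Lv) * w).
  rewrite eE mulrA -expRD -mulrDr -LE; congr (expR _ * _).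
  by rewrite /k mulrA divfK ?gt_eqF.
apply: (le_trans (ler_pM _ _ gle wle)); rewrite ?expR_ge0 ?mulr_ge0 ?expR_ge0 ?(ltW w0)//.
rewrite le_eqVlt; apply/orP; left; apply/eqP.
have tt : t `^ (k - 1) * t `^ (1 - k) = 1 by rewrite !tE -expRD -[RHS]expR0; congr expR; lra.
rewrite -[RHS]mul1r -[X in _ = X * _]tt; ring.
Qed.
End real_bound.

Section hardy_on_volume.
Local Open Scope ereal_scope.
Context d (X : measurableType d) (R : realType).
Variable mu : {sigma_finite_measure set X -> \bar R}.
Variable b : X -> R.
Hypothesis mb : measurable_fun setT b.
Hypothesis mub : forall t : R, (0 <= t)%R -> mu (sublevel b t) = t%:E.

Local Notation sublevel := (sublevel b).
Local Notation pos_set := (pos_set b).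

Let mu_sublevel t : (0 <= t)%R -> (mu : {measure set X -> \bar R}) (sublevel t) = t%:E.
Proof. exact: mub. Qed.

Variables (u v f : X -> R) (p q D : R).
Hypotheses (mv : measurable_fun setT v) (mf : measurable_fun setT f).
Hypotheses (u0 : forall x, pos_set x -> (0 < u x)%R)
  (v0 : forall x, pos_set x -> (0 < v x)%R) (f0 : forall x, pos_set x -> (0 < f x)%R).
Hypotheses (p0 : (0 < p)%R) (pq : (p <= q)%R) (D0 : (0 < D)%R).
Hypothesis Dle : forall x, pos_set x ->
  (b x `^ (q^-1 - p^-1) * u x `^ q^-1)%:E *
  expeR ((b x)^-1%:E * \int[mu]_(y in sublevel (b x)) (ln (v y)^-1)%:E) `^ p^-1 <= D%:E.

Let g x := (f x `^ p * v x)%R.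
Let k := (q / p)%R.

Let q0 : (0 < q)%R. Proof. exact: lt_le_trans pq. Qed.
Let k1 : (1 <= k)%R. Proof. by rewrite ler_pdivlMr// mul1r. Qed.
Let k0 : (0 < k)%R. Proof. exact: lt_le_trans k1. Qed.

Let mg : measurable_fun setT g.
Proof. by apply: measurable_funM => //; exact: (measurableT_comp (measurable_powR _)). Qed.

Let g0 x : pos_set x -> (0 < g x)%R.
Proof. by move=> bx; rewrite mulr_gt0 ?powR_gt0 ?f0 ?v0. Qed.

Let sublevel_sub t : sublevel t `<=` pos_set. Proof. by move=> x []. Qed.

Let mpos_set : measurable pos_set. Proof. exact: measurable_pos_set. Qed.
Let msublevel t : measurable (sublevel t). Proof. exact: measurable_sublevel. Qed.

Let mbk a : measurable_fun setT (fun x => b x `^ a)%R.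
Proof. exact: (measurableT_comp (measurable_powR _)). Qed.

Let mgbk : measurable_fun setT (fun x => g x * b x `^ k)%R.
Proof. exact: measurable_funM. Qed.

(** Where the integral of log f over the ball is -oo the left-hand side is
zero; everywhere else all the integrals involved are finite and the estimate is
the one for reals. *)
Lemma hardy_pointwise (A : R) x : \int[mu]_(y in pos_set) (g y)%:E = A%:E -> pos_set x ->
  (expeR ((b x)^-1%:E * \int[mu]_(y in sublevel (b x)) (ln (f y))%:E)) `^ q * (u x)%:E <=
  (D `^ q * expR k * A `^ (k - 1))%:E *
  ((b x `^ (- k - 1))%:E * \int[mu]_(y in sublevel (b x)) (g y * b y `^ k)%:E).
Proof.
move=> AE bx; set t := b x; have t0 : (0 < t)%R by [].
have A0 : (0 <= A)%R.
  by rewrite -lee_fin -AE; apply: integral_ge0 => y /g0/ltW; rewrite lee_fin.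
have gA : \int[mu]_(y in sublevel t) (g y)%:E <= A%:E.
  rewrite -AE; apply: ge0_subset_integral => //.
  - by apply/measurable_EFinP; exact: measurable_funTS.
  - by move=> y /g0/ltW; rewrite lee_fin.
have I10 : 0 <= \int[mu]_(y in sublevel t) (g y * b y `^ k)%:E.
  by apply: integral_ge0 => y /sublevel_sub/g0/ltW gy; rewrite lee_fin mulr_ge0 ?powR_ge0.
have I1oo : \int[mu]_(y in sublevel t) (g y * b y `^ k)%:E < +oo.
  rewrite (@le_lt_trans _ _ ((t `^ k)%:E * A%:E))// -?EFinM ?ltry//.
  rewrite EFinM (le_trans _ (lee_wpmul2l _ gA)) ?lee_fin ?powR_ge0//.
  rewrite -ge0_integralZl//; last 3 first.
  - by apply/measurable_EFinP; exact: measurable_funTS.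
  - by move=> y /sublevel_sub/g0/ltW; rewrite lee_fin.
  - by rewrite lee_fin powR_ge0.
  apply: integral_mono => y [by0 byt]; rewrite -EFinM lee_fin mulrC ler_wpM2r//.
    by rewrite ltW// g0.
  by rewrite ge0_ler_powR ?nnegrE// ?ltW.
(* the geometric mean vanishes: this also covers the undefined integrals *)
have [->|If] := eqVneq (\int[mu]_(y in sublevel t) (ln (f y))%:E) -oo.
  rewrite gt0_muleNy ?lte_fin ?invr_gt0// /expeR poweR0r ?gt_eqF// mul0e.
  apply: mule_ge0; first by rewrite lee_fin !mulr_ge0 ?powR_ge0 ?expR_ge0.
  by apply: mule_ge0 => //; rewrite lee_fin powR_ge0.
rewrite -ltNye in If.
have w0 := u0 bx.
have Iv : \int[mu]_(y in sublevel t) (ln (v y)^-1)%:E < +oo.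
  rewrite ltey; apply/eqP => E; have := Dle bx; rewrite -/t E.
  rewrite gt0_muley ?lte_fin ?invr_gt0// /expeR poweRyr ?gt_eqF ?invr_gt0//.
  by rewrite gt0_muley ?lte_fin ?mulr_gt0 ?powR_gt0// leye_eq.
have [iF iV] : mu.-integrable (sublevel t) (fun x => (ln (f x))%:E) /\
    mu.-integrable (sublevel t) (fun x => (ln (v x)^-1)%:E).
  apply: (@integrable_ln_weighted _ X R mu (sublevel t) f v p) => //.
  - exact: measurable_funTS.
  - exact: measurable_funTS.
  - by move=> y /sublevel_sub; exact: f0.
  - by move=> y /sublevel_sub; exact: v0.
  - exact: le_lt_trans gA (ltry _).
have [ib ibE] := integral_volume_ln mb mub t0.
have [IF IFE] : exists r, \int[mu]_(y in sublevel t) (ln (f y))%:E = r%:E.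
  by exists (fine (\int[mu]_(y in sublevel t) (ln (f y))%:E)); rewrite fineK// integrable_fin_num.
have [IV IVE] : exists r, \int[mu]_(y in sublevel t) (ln (v y)^-1)%:E = r%:E.
  by exists (fine (\int[mu]_(y in sublevel t) (ln (v y)^-1)%:E)); rewrite fineK// integrable_fin_num.
have [I1 I1E] : exists r, \int[mu]_(y in sublevel t) (g y * b y `^ k)%:E = r%:E.
  by exists (fine (\int[mu]_(y in sublevel t) (g y * b y `^ k)%:E)); rewrite fineK// ge0_fin_numE.
have lngE y : y \in sublevel t -> (ln (g y))%:E = p%:E * (ln (f y))%:E - (ln (v y)^-1)%:E.
  move=> /set_mem/sublevel_sub by0; rewrite -EFinM -EFinB /g lnM ?posrE ?powR_gt0 ?f0 ?v0//.
  by rewrite ln_powR lnV ?posrE ?v0// opprK.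
have ipF : mu.-integrable (sublevel t) (fun y => p%:E * (ln (f y))%:E) by exact: integrableZl.
have IGE : \int[mu]_(y in sublevel t) (ln (g y))%:E = (p * IF - IV)%:E.
  rewrite (eq_integral (fun y => p%:E * (ln (f y))%:E - (ln (v y)^-1)%:E))//.
  by rewrite integralB// integralZl// IFE IVE.
have ig : mu.-integrable (sublevel t) (fun y => (ln (g y))%:E).
  apply: (eq_integrable (msublevel t) (fun y => p%:E * (ln (f y))%:E - (ln (v y)^-1)%:E)).
    by move=> y yt; rewrite lngE.
  exact: integrableB.
(* Jensen's inequality for g and for g b^k *)
have J1 : (expR (t^-1 * (p * IF - IV)) <= t^-1 * A)%R.
  have := @expeR_mean_ln _ X R mu (sublevel t) t g (msublevel t) (mu_sublevel (ltW t0)) t0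
    (measurable_funTS mg) (fun y yt => g0 (sublevel_sub yt)).
  rewrite IGE -EFinM /= => /le_trans h; rewrite -lee_fin; apply: h.
  by rewrite EFinM lee_pmul2l// lte_fin invr_gt0.
have gbk0 y : sublevel t y -> (0 < g y * b y `^ k)%R.
  by move=> [by0 byt]; rewrite mulr_gt0 ?powR_gt0 ?g0.
have J2 : (expR (t^-1 * (p * IF - IV) + k * (ln t - 1)) <= t^-1 * I1)%R.
  have := @expeR_mean_ln _ X R mu (sublevel t) t _ (msublevel t) (mu_sublevel (ltW t0)) t0
    (measurable_funTS mgbk) gbk0.
  rewrite (eq_integral (fun y => (ln (g y))%:E + k%:E * (ln (b y))%:E)); last first.
    move=> y /set_mem [by0 _]; rewrite lnM ?posrE ?powR_gt0 ?g0//.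
    by rewrite ln_powR EFinD EFinM.
  rewrite integralD//; last exact: integrableZl.
  rewrite integralZl// ibE IGE I1E -!EFinM /= lee_fin.
  have -> // : (t^-1 * (p * IF - IV + k * (t * ln t - t)) =
    t^-1 * (p * IF - IV) + k * (ln t - 1))%R.
  by field; rewrite gt_eqF.
rewrite IFE I1E -!EFinM /= -?EFinM lee_fin.
apply: (@pointwise_real_bound _ p q t D A (u x) _ (t^-1 * (p * IF - IV)) (t^-1 * IV)) => //.
  by ring.
by have := Dle bx; rewrite -/t IVE -EFinM /= -?EFinM lee_fin.
Qed.

(** Tonelli: a point y contributes g(y) b(y)^k times the integral of b^(-k-1)
over {b >= b(y)}, which is g(y) / k. *)
Lemma integral_hardy_kernel :
  \int[mu]_(x in pos_set) ((b x `^ (- k - 1))%:E *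
     \int[mu]_(y in sublevel (b x)) (g y * b y `^ k)%:E) =
  k^-1%:E * \int[mu]_(y in pos_set) (g y)%:E /\
  measurable_fun pos_set (fun x => (b x `^ (- k - 1))%:E *
     \int[mu]_(y in sublevel (b x)) (g y * b y `^ k)%:E).
Proof.
pose B : set (X * X) := [set z | (0 < b z.2)%R /\ (b z.2 <= b z.1)%R].
have m1 : measurable_fun setT (fun z : X * X => b z.1).
  exact: (measurableT_comp mb measurable_fst).
have m2 : measurable_fun setT (fun z : X * X => b z.2).
  exact: (measurableT_comp mb measurable_snd).
have mB : measurable B.
  by apply: measurableI; [exact: measurable_set_lt|exact: measurable_set_le].
pose F (z : X * X) := (\1_B z * (b z.1 `^ (- k - 1) * (g z.2 * b z.2 `^ k)))%R.
have mF : measurable_fun setT (fun z => (F z)%:E).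
  apply/measurable_EFinP; apply: measurable_funM; first exact: measurable_indic.
  apply: measurable_funM; first exact: (measurableT_comp (mbk _) measurable_fst).
  exact: (measurableT_comp mgbk measurable_snd).
have F0 z : 0 <= (F z)%:E.
  rewrite /F indicE lee_fin; have [|_] := boolP (z \in B); last by rewrite mul0r.
  move=> /set_mem [/= z20 _]; rewrite mul1r mulr_ge0 ?powR_ge0// mulr_ge0 ?powR_ge0//.
  by rewrite ltW// g0.
have FE x : \int[mu]_y (F (x, y))%:E = (b x `^ (- k - 1))%:E *
    \int[mu]_(y in sublevel (b x)) (g y * b y `^ k)%:E.
  rewrite -ge0_integralZl//; last 3 first.
  - by apply/measurable_EFinP; exact: measurable_funTS.
  - by move=> y /sublevel_sub/g0/ltW gy; rewrite lee_fin mulr_ge0 ?powR_ge0.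
  - by rewrite lee_fin powR_ge0.
  rewrite [RHS]integral_mkcond; apply: eq_integral => y _; rewrite patchE /F indicE.
  have -> : ((x, y) \in B) = (y \in sublevel (b x)) by apply/idP/idP; rewrite !inE.
  by case: ifPn => _; rewrite ?mul1r ?mul0r// EFinM.
split; last first.
  apply: measurable_funTS.
  have := @measurable_fun_fubini_tonelli_F _ _ X X R mu (fun z => (F z)%:E) mF F0.
  by apply: eq_measurable_fun => x _; exact: FE.
have -> : \int[mu]_(x in pos_set) ((b x `^ (- k - 1))%:E *
    \int[mu]_(y in sublevel (b x)) (g y * b y `^ k)%:E) =
    \int[mu]_x \int[mu]_y (F (x, y))%:E.
  rewrite integral_mkcond; apply: eq_integral => x _; rewrite patchE FE.
  case: ifPn => // /negP bx; rewrite (_ : sublevel (b x) = set0).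
    by rewrite integral_set0 mule0.
  apply/seteqP; split => // y [y0 yx]; apply: bx; rewrite inE.
  exact: lt_le_trans y0 yx.
rewrite (@fubini_tonelli _ _ X X R mu mu (fun z => (F z)%:E) mF F0).
rewrite -ge0_integralZl//; last 3 first.
- by apply/measurable_EFinP; exact: measurable_funTS.
- by move=> y /g0/ltW; rewrite lee_fin.
- by rewrite lee_fin invr_ge0 ltW.
rewrite [RHS]integral_mkcond; apply: eq_integral => y _; rewrite patchE.
case: ifPn => [/set_mem by0|/negP by0]; last first.
  rewrite integral0_eq// => x _; rewrite /F indicE memNset ?mul0r// => -[/= y0 _].
  by apply: by0; rewrite inE.
transitivity (\int[mu]_(x in [set x | (b y <= b x)%R])
    ((g y * b y `^ k)%:E * (b x `^ (- k - 1))%:E)).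
  rewrite [RHS]integral_mkcond; apply: eq_integral => x _; rewrite patchE /F indicE.
  have -> : ((x, y) \in B) = (x \in [set x | (b y <= b x)%R]).
    by apply/idP/idP => /set_mem h; apply/mem_set; [case: h|split].
  by case: ifPn => _; rewrite ?mul1r ?mul0r// -EFinM mulrC.
rewrite ge0_integralZl//; last 4 first.
- exact: measurable_set_le.
- by apply/measurable_EFinP; exact: measurable_funTS.
- by move=> x _; rewrite lee_fin powR_ge0.
- by rewrite lee_fin mulr_ge0 ?powR_ge0// ltW// g0.
rewrite integral_volume_powRN// -!EFinM; congr EFin.
rewrite powRN; field.
by rewrite gt_eqF//= gt_eqF// powR_gt0.
Qed.

(** D is any positive upper bound of the supremum, so that the product with an
infinite right-hand side is infinite. *)
Lemma hardy_on_volume :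
  (\int[mu]_(x in pos_set) (expeR ((b x)^-1%:E *
     \int[mu]_(y in sublevel (b x)) (ln (f y))%:E) `^ q * (u x)%:E)) `^ q^-1 <=
  (D * ((p / q) `^ q^-1 * expR p^-1))%:E * (\int[mu]_(x in pos_set) (g x)%:E) `^ p^-1.
Proof.
have K0 : (0 < D * ((p / q) `^ q^-1 * expR p^-1))%R.
  by rewrite !mulr_gt0 ?powR_gt0 ?expR_gt0// divr_gt0.
have ig0 : 0 <= \int[mu]_(x in pos_set) (g x)%:E.
  by apply: integral_ge0 => x /g0/ltW; rewrite lee_fin.
have [->|Aoo] := eqVneq (\int[mu]_(x in pos_set) (g x)%:E) +oo.
  by rewrite poweRyr ?gt_eqF ?invr_gt0// gt0_muley ?lte_fin// leey.
have [A AE] : exists A, \int[mu]_(x in pos_set) (g x)%:E = A%:E.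
  by exists (fine (\int[mu]_(x in pos_set) (g x)%:E)); rewrite fineK// ge0_fin_numE// ltey.
have A0 : (0 <= A)%R by rewrite -lee_fin -AE.
have [KE mK] := integral_hardy_kernel.
have c0 : 0 <= (D `^ q * expR k * A `^ (k - 1))%:E.
  by rewrite lee_fin !mulr_ge0 ?powR_ge0 ?expR_ge0.
have le1 := integral_mono mu (fun x => @hardy_pointwise A x AE).
rewrite ge0_integralZl// in le1; last first.
  move=> x bx; apply: mule_ge0; first by rewrite lee_fin powR_ge0.
  by apply: integral_ge0 => y /sublevel_sub/g0/ltW gy; rewrite lee_fin mulr_ge0 ?powR_ge0.
rewrite KE AE -!EFinM in le1.
have l0 : 0 <= \int[mu]_(x in pos_set) (expeR ((b x)^-1%:E *
     \int[mu]_(y in sublevel (b x)) (ln (f y))%:E) `^ q * (u x)%:E).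
  by apply: integral_ge0 => x bx; rewrite mule_ge0 ?poweR_ge0// lee_fin ltW ?u0.
have := @gt0_ler_poweR R q^-1 _ _ _ _ _ le1.
rewrite invr_ge0 (ltW q0) => /(_ isT).
rewrite !in_itv/= !leey !andbT l0 lee_fin !mulr_ge0 ?powR_ge0 ?expR_ge0 ?invr_ge0 ?(ltW k0)//.
move=> /(_ isT isT) /le_trans; apply; rewrite AE /= -EFinM lee_fin le_eqVlt; apply/orP; left.
have -> : (D `^ q * expR k * A `^ (k - 1) * (k^-1 * A) = D `^ q * expR k * k^-1 * A `^ k)%R.
  by rewrite -(mulr_powRB1 A0 k0); ring.
rewrite ![in eqbLHS]powRM ?mulr_ge0 ?powR_ge0 ?expR_ge0 ?invr_ge0 ?(ltW k0)//.
rewrite -!powRrM (mulfV (lt0r_neq0 q0)) (powRr1 (ltW D0)).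
have -> : (k / q = p^-1)%R by rewrite /k; field; rewrite !gt_eqF.
have -> : (expR k `^ q^-1 = expR p^-1)%R.
  rewrite /powR gt_eqF ?expR_gt0// expRK; congr expR.
  by rewrite /k; field; rewrite !gt_eqF.
have -> : (k^-1 = p / q)%R by rewrite /k invf_div.
by apply/eqP; ring.
Qed.

End hardy_on_volume.

(** * Lebesgue measure on row vectors and dilations *)

Section rV_measurability.
Context {R : realType} (n : nat).

Lemma measurable_box (A : 'I_n -> set R) : (forall i, measurable (A i)) ->
  measurable [set x : 'rV[R]_n | forall i, A i (x ord0 i)].
Proof.
move=> mA; rewrite (_ : mkset _ = \bigcap_(i in [set: 'I_n])
    ((fun x : 'rV[R]_n => x ord0 i) @^-1` A i)); last first.
  by apply/seteqP; split => [x h i _|x h i]; exact: h.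
apply: fin_bigcap_measurable => // i _.
by rewrite -[X in measurable X]setTI; exact: measurable_coord_rV.
Qed.

Definition grid_point (k : nat) (z : 'rV[int]_n) : 'rV[R]_n :=
  \row_i ((z ord0 i)%:~R / k.+1%:R).

Definition grid_index (k : nat) (x : 'rV[R]_n) : 'rV[int]_n :=
  \row_i Num.floor (x ord0 i * k.+1%:R).

Lemma measurable_grid_index k (z : 'rV[int]_n) : measurable [set x : 'rV[R]_n | grid_index k x = z].
Proof.
rewrite (_ : mkset _ = [set x : 'rV[R]_n | forall i,
    [set y : R | Num.floor (y * k.+1%:R) = z ord0 i] (x ord0 i)]); last first.
  apply/seteqP; split => x /=; first by move=> <- i; rewrite mxE.
  by move=> h; apply/rowP => i; rewrite mxE h.
apply: (@measurable_box (fun i => [set y : R | Num.floor (y * k.+1%:R) = z ord0 i])) => i.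
rewrite (_ : mkset _ = [set y : R | (z ord0 i)%:~R <= y * k.+1%:R] `&`
    [set y : R | y * k.+1%:R < (z ord0 i + 1)%:~R]); last first.
  apply/seteqP; split => y /=.
    by move=> <-; have /andP[] := floor_itv (y * k.+1%:R).
  by move=> [h1 h2]; apply: floor_def; rewrite h1.
by apply: measurableI; [apply: measurable_set_le|apply: measurable_set_lt] => //;
  apply: measurable_funM.
Qed.

Lemma cvg_grid_point (x : 'rV[R]_n) : grid_point k (grid_index k x) @[k --> \oo] --> x.
Proof.
apply/cvg_ballP => e e0; near=> k; split=> // i j; rewrite /ball/= !mxE ord1.
have k0 : 0 < k.+1%:R :> R by [].
have /andP[h1 h2] := floor_itv (x ord0 j * k.+1%:R).
have ke : k.+1%:R^-1 < e.
  near: k; exact: near_infty_natSinv_lt (PosNum e0).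
set m := Num.floor _ in h1 h2 *.
have -> : x ord0 j - m%:~R / k.+1%:R = (x ord0 j * k.+1%:R - m%:~R) / k.+1%:R.
  by field; rewrite gt_eqF.
rewrite ger0_norm ?divr_ge0 ?subr_ge0//; apply: le_lt_trans ke.
rewrite -[leRHS]mul1r ler_pM2r ?invr_gt0// lerBlDl (le_trans (ltW h2))//.
by rewrite intrD.
Unshelve. all: by end_near. Qed.

(** Rounding down to a lattice takes countably many values, each on a box, so f
after rounding is measurable; it converges to f by continuity. *)
Lemma continuous_measurable_rV (f : 'rV[R]_n -> R) : continuous f ->
  measurable_fun setT f.
Proof.
move=> cf; apply: (@measurable_fun_cvg _ _ _ _ (fun k x => f (grid_point k (grid_index k x)))).
  move=> k _ A mA; rewrite setTI.
  rewrite (_ : _ @^-1` A = \bigcup_(m : nat)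
      [set x | exists2 z, unpickle m = Some z & grid_index k x = z /\ A (f (grid_point k z))]).
    apply: bigcupT_measurable => m; case E : (unpickle m) => [z|]; last first.
      by rewrite (_ : mkset _ = set0)//; apply/seteqP; split => // x [z].
    have [Az|nAz] := pselect (A (f (grid_point k z))).
      rewrite (_ : mkset _ = [set x | grid_index k x = z]); first exact: measurable_grid_index.
      by apply/seteqP; split => x /=; [case=> _ [<-] []|move=> h; exists z].
    rewrite (_ : mkset _ = set0)//; apply/seteqP; split => // x [_ [<-] [_]].
    exact: nAz.
  apply/seteqP; split => x /=; last by case=> m _ [z _ [<-]].
  by move=> Ax; exists (pickle (grid_index k x)) => //; exists (grid_index k x); rewrite ?pickleK.
by move=> x _; apply: continuous_cvg; [exact: cf|exact: cvg_grid_point].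
Qed.

End rV_measurability.

Section lebesgue_rV_dilation.
Context {R : realType}.

Lemma lebesgue_measure_scale (c : R) (A : set R) : 0 < c -> measurable A ->
  (lebesgue_measure ((fun x => c * x)%R @^-1` A) = c^-1%:E * lebesgue_measure A)%E.
Proof.
move=> c0 mA.
have mc : measurable_fun setT ((fun x => c * x) : R -> measurableTypeR R).
  exact: measurable_funM.
pose m : {measure set (measurableTypeR R) -> \bar R} :=
  mscale (NngNum (ltW c0)) (image_measure (@lebesgue_measure R) mc).
have mE B : (m B = c%:E * lebesgue_measure ((fun x => c * x)%R @^-1` B))%E by [].
have -> : lebesgue_measure A = m A.
  apply: (@lebesgue_measure_unique R m) => // _ [[x y]] _ <-; rewrite mE/=.
  rewrite (_ : _ @^-1` _ = `]x / c, y / c]%classic); last first.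
    apply/seteqP; split => z /=; rewrite !in_itv/= ler_pdivlMr// ltr_pdivrMr//.
      by rewrite mulrC.
    by rewrite mulrC.
  rewrite !lebesgue_measure_itv/= !lte_fin ltr_pM2r ?invr_gt0//.
  case: ifPn; rewrite ?mule0// => _; rewrite -!EFinB -EFinM; congr EFin.
  by field; rewrite gt_eqF.
by rewrite mE muleA -EFinM mulVf ?gt_eqF// mul1e.
Qed.

Lemma prod_powR (I : Type) (s : seq I) (a : I -> R) (c : R) : 0 < c ->
  \prod_(i <- s) (c `^ a i) = c `^ (\sum_(i <- s) a i).
Proof.
move=> c0; have E r : c `^ r = expR (r * ln c) by rewrite /powR gt_eqF.
by rewrite E mulr_suml expR_sum; apply: eq_bigr => i _; rewrite E.
Qed.

Context (n : nat) (w : 'I_n -> R).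

Lemma measurable_dilation2 :
  measurable_fun setT (fun z : R * 'rV[R]_n => dilation w z.1 z.2).
Proof.
apply: measurable_fun_rV => i; under eq_fun do rewrite mxE.
apply: measurable_funM.
  exact: (measurableT_comp (measurable_powR _) measurable_fst).
exact: (measurableT_comp (measurable_coord_rV i) measurable_snd).
Qed.

Lemma measurable_dilation c : measurable_fun setT (@dilation R n w c).
Proof.
apply: measurable_fun_rV => i; under eq_fun do rewrite mxE.
by apply: measurable_funM => //; exact: measurable_coord_rV.
Qed.

Lemma dilationM a c x : 0 <= a -> 0 <= c ->
  dilation w a (dilation w c x) = dilation w (a * c) x.
Proof. by move=> a0 c0; apply/rowP => i; rewrite !mxE powRM// mulrA. Qed.

Lemma dilation1 x : dilation w 1 x = x.
Proof. by apply/rowP => i; rewrite mxE powR1 mul1r. Qed.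

(** Both sides are measures in A, and they agree on boxes by the
one-dimensional scaling of Lebesgue measure in every coordinate. *)
Lemma lebesgue_rV_dilation (c : R) (A : set 'rV[R]_n) : 0 < c -> measurable A ->
  (lebesgue_rV n (dilation w c @^-1` A) =
   (c `^ (- \sum_i w i))%:E * lebesgue_rV n A)%E.
Proof.
move=> c0 mA; set Q := \sum_i w i.
have mc := measurable_dilation c.
pose m1 := image_measure (lebesgue_rV n) mc.
have cQ0 : 0 <= c `^ (- Q) by exact: powR_ge0.
pose m2 : {measure set 'rV[R]_n -> \bar R} := mscale (NngNum cQ0) (lebesgue_rV n).
suff : m1 A = m2 A by [].
pose box (B : 'I_n -> set R) := [set x : 'rV[R]_n | forall i, B i (x ord0 i)].
pose G := [set D | exists2 B : 'I_n -> set R, (forall i, measurable (B i)) & D = box B].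
apply: (measure_unique G (fun k => box (fun=> `[- k%:R, k%:R]%classic))) => //.
- apply/seteqP; split => D.
    apply: smallest_sub; first exact: smallest_sigma_algebra.
    move=> E; rewrite -bigcup_seq => -[i _ [B mB <-]]; apply: sub_sigma_algebra.
    exists (fun j => if j == i then B else setT).
      by move=> j; case: ifPn.
    rewrite setTI; apply/seteqP; split => x /=; first by move=> Bx j; case: eqP => // ->.
    by move=> /(_ i); rewrite eqxx.
  apply: smallest_sub; first exact: sigma_algebra_measurable.
  by move=> _ [B mB ->]; exact: measurable_box.
- move=> _ _ [B mB ->] [C mC ->]; exists (fun i => B i `&` C i).
    by move=> i; exact: measurableI.
  apply/seteqP; split => x /=; first by move=> [Bx Cx] i; split.
  by move=> h; split => i; have [] := h i.
- by move=> k; exists (fun=> `[- k%:R, k%:R]%classic).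
- apply/seteqP; split => // x _; pose M := \big[Num.max/0]_i `|x ord0 i|.
  have M0 : 0 <= M by rewrite /M; apply: bigmax_ge_id.
  exists (Num.bound M) => // i; rewrite /= in_itv/= -ler_norml.
  by apply: (le_trans _ (ltW (archi_boundP M0))); apply: le_bigmax.
- move=> _ [B mB ->].
  have -> : m1 (box B) = lebesgue_rV n (box (fun i => (fun x => c `^ w i * x) @^-1` B i)).
    by congr (lebesgue_rV n _); apply/seteqP; split => x /= h i; have := h i; rewrite mxE.
  have -> : m2 (box B) = ((c `^ (- Q))%:E * lebesgue_rV n (box B))%E by [].
  rewrite !lebesgue_rV_box//; last first.
    move=> i; rewrite -[X in measurable X]setTI.
    by apply: (measurable_funM (measurable_cst _) (@measurable_id _ _ _)).
  rewrite (eq_bigr (fun i => (c `^ (- w i))%:E * lebesgue_measure (B i))%E); last first.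
    by move=> i _; rewrite lebesgue_measure_scale ?powR_gt0// powRN.
  by rewrite big_split/= prodEFin prod_powR// sumrN.
- move=> k; have -> : m1 (box (fun=> `[- k%:R, k%:R]%classic)) =
    lebesgue_rV n (box (fun i => (fun x => c `^ w i * x) @^-1` `[- k%:R, k%:R]%classic)).
    by congr (lebesgue_rV n _); apply/seteqP; split => x /= h i; have := h i; rewrite mxE.
  rewrite lebesgue_rV_box; last first.
    move=> i; rewrite -[X in measurable X]setTI.
    by apply: (measurable_funM (measurable_cst _) (@measurable_id _ _ _)).
  rewrite (eq_bigr (fun i => ((c `^ w i)^-1 * (k%:R + k%:R))%:E)); last first.
    move=> i _; rewrite lebesgue_measure_scale ?powR_gt0// lebesgue_measure_itv/= lte_fin.
    case: ltP => [_|kk]; first by rewrite -EFinB -EFinM opprK.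
    rewrite mule0 (_ : k%:R = 0) ?addr0 ?mulr0//.
    by apply/eqP; rewrite eq_le ler0n andbT; move: kk; rewrite lerNr; lra.
  by rewrite prodEFin ltry.
Qed.

End lebesgue_rV_dilation.

(** * Quasi-balls *)

Section quasi_ball.
Context {R : realType} (N : nat) (G : homogeneous_group R N.+1).
Variable nrm : quasi_norm G.

Local Notation mu := (lebesgue_rV N.+1 : {sigma_finite_measure set 'rV[R]_N.+1 -> \bar R}).
Local Notation w := (hg_wt G).
Local Notation Q := (hdim G).
Local Notation dil := (dilation w).

Lemma hdim_gt0 : 0 < Q.
Proof.
rewrite /hdim big_ord_recl ltr_wpDr ?hg_wt_gt0//.
by apply: sumr_ge0 => i _; rewrite ltW// hg_wt_gt0.
Qed.

Lemma measurable_qn : measurable_fun setT nrm.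
Proof. by apply: continuous_measurable_rV => x; exact: qn_continuous. Qed.

Lemma qn_gt0 x : (0 < nrm x) = (x != 0).
Proof.
rewrite lt_def qn_ge0 andbT; congr negb; apply/eqP/eqP => [h|->].
  by apply/(qn_eq0 nrm).
by apply/(qn_eq0 nrm).
Qed.

Lemma measurable_qball r : measurable (qball nrm r).
Proof. by apply: measurable_set_lt => //; exact: measurable_qn. Qed.

Lemma lebesgue_rV_set0 : lebesgue_rV N.+1 [set (0 : 'rV[R]_N.+1)] = 0%E.
Proof.
rewrite (_ : [set 0] = [set x : 'rV[R]_N.+1 | forall i, [set (0:R)] (x ord0 i)]).
  by rewrite (@lebesgue_rV_box R N.+1 (fun=> [set 0]))// big_ord_recl lebesgue_measure_set1 mul0e.
apply/seteqP; split => x /=; first by move=> -> i; rewrite mxE.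
by move=> h; apply/rowP => i; rewrite h mxE.
Qed.

Lemma qballZ (r : R) : 0 < r ->
  (lebesgue_rV N.+1 (qball nrm r) = (r `^ Q)%:E * lebesgue_rV N.+1 (qball nrm 1))%E.
Proof.
move=> r0; have ri0 : 0 < r^-1 by rewrite invr_gt0.
have -> : qball nrm r = dil r^-1 @^-1` qball nrm 1.
  apply/seteqP; split => x; rewrite /qball/= qnZ// mulrC ltr_pdivrMr// mul1r //.
rewrite lebesgue_rV_dilation//; last exact: measurable_qball.
by rewrite -powR_inv1 ?(ltW r0)// -powRrM mulN1r opprK.
Qed.

(** Two opposite faces of the cube form a compact set without 0, so the
quasi-norm has a positive minimum there. *)
Lemma qn_face (i : 'I_N.+1) : exists2 c : R, 0 < c &
  forall x : 'rV[R]_N.+1, (forall j, `|x ord0 j| <= 1) -> `|x ord0 i| = 1 -> c <= nrm x.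
Proof.
pose A j : set R := if j == i then [set 1] `|` [set -1] else `[-1, 1]%classic.
pose K := [set x : 'rV[R]_N.+1 | forall j, A j (x ord0 j)].
have cK : compact K.
  apply: rV_compact => j; rewrite /A; case: eqP => _; last exact: segment_compact.
  by apply: compactU; exact: compact_set1.
have K0 : K !=set0.
  exists (const_mx 1) => j; rewrite mxE /A; case: eqP => _; first by left.
  by rewrite /= in_itv/= lexx andbT lerNl; lra.
have [x Kx xmin] := compact_EVT_min K0 cK (continuous_subspaceT (@qn_continuous _ _ _ nrm)).
exists (nrm x).
  rewrite qn_gt0; apply/eqP => x0; have := set_mem Kx i; rewrite x0 mxE /A eqxx => -[] /= /eqP.
    by rewrite eq_sym oner_eq0.
  by rewrite eq_sym oppr_eq0 oner_eq0.
move=> y y1 yi; apply: xmin; rewrite inE => j; rewrite /A; case: eqP => [->|_].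
  have [y0|y0] := leP 0 (y ord0 i).
    by left; rewrite /= -yi ger0_norm.
  by right; rewrite /= -yi ltr0_norm// opprK.
by rewrite /= in_itv/= -ler_norml.
Qed.

(** A point outside the cube is brought to one of its faces by a dilation of
ratio less than 1, which decreases the quasi-norm; so the minimum over the
faces bounds the quasi-norm from below outside the cube. *)
Lemma qball_bounded : exists2 c : R, 0 < c &
  qball nrm c `<=` [set x | forall i, `[-1, 1]%classic (x ord0 i)].
Proof.
have /choice[c /all_and2[c0 cP]] : forall i, exists c, 0 < c /\
    forall x : 'rV[R]_N.+1, (forall j, `|x ord0 j| <= 1) -> `|x ord0 i| = 1 -> c <= nrm x.
  by move=> i; have [c c0 h] := qn_face i; exists c.
exists (\big[Num.min/1]_i c i).
  by apply: lt_bigmin => // i _.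
move=> x xc i; rewrite /= in_itv/= -ler_norml leNgt; apply/negP => xi.
have e1 (a : R) : 1 = 1 `^ a by rewrite powR1.
(* the ratio that brings coordinate j back to absolute value 1; the smallest of
   them brings the whole point onto a face *)
pose F j := if `|x ord0 j| <= 1 then 1 else `|x ord0 j| `^ (- (w j)^-1).
have FP j : 1 < `|x ord0 j| -> F j = `|x ord0 j| `^ (- (w j)^-1) /\ F j < 1.
  move=> xj; rewrite /F leNgt xj /=; split => //.
  rewrite powRN invf_lt1 ?powR_gt0 ?(lt_trans _ xj)//.
  rewrite [X in X < _](e1 (w j)^-1) gt0_ltr_powR ?invr_gt0 ?hg_wt_gt0 ?nnegrE//.
have [m _ mmin] := @arg_minP _ R _ i xpredT F erefl.
have Fm1 : F m < 1 by apply: le_lt_trans (mmin i erefl) (FP i xi).2.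
have xm : 1 < `|x ord0 m| by rewrite ltNge; apply/negP => h; move: Fm1; rewrite /F h ltxx.
have [FmE _] := FP m xm.
have Fm0 : 0 < F m by rewrite FmE powR_gt0// (lt_trans _ xm).
have xm0 : 0 < `|x ord0 m| by exact: lt_trans xm.
have h1 j : `|dil (F m) x ord0 j| <= 1.
  rewrite mxE normrM ger0_norm ?powR_ge0//.
  have [xj|xj] := leP `|x ord0 j| 1.
    rewrite mulr_ile1 ?powR_ge0// [leRHS](e1 (w j)).
    by rewrite ge0_ler_powR ?nnegrE ?(ltW (hg_wt_gt0 _ _)) ?(ltW Fm0) ?(ltW Fm1).
  have xj0 : 0 < `|x ord0 j| by exact: lt_trans xj.
  rewrite -ler_pdivlMr// mul1r.
  have -> : `|x ord0 j|^-1 = F j `^ w j.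
    by rewrite (FP j xj).1 -powRrM mulNr mulVf ?gt_eqF ?hg_wt_gt0// powR_inv1 ?ltW.
  have Fj0 : 0 <= F j by rewrite (FP j xj).1 powR_ge0.
  by rewrite ge0_ler_powR ?nnegrE ?(ltW (hg_wt_gt0 _ _)) ?(ltW Fm0)// mmin.
have h2 : `|dil (F m) x ord0 m| = 1.
  rewrite mxE normrM ger0_norm ?powR_ge0// FmE -powRrM mulNr mulVf ?gt_eqF ?hg_wt_gt0//.
  by rewrite powR_inv1 ?ltW// mulVf ?gt_eqF.
have := cP m _ h1 h2; rewrite qnZ// => cle.
have : c m < c m.
  apply: (le_lt_trans cle); apply: (@lt_le_trans _ _ (nrm x * 1)).
    rewrite mulrC ltr_pM2l// qn_gt0; apply/eqP => x0.
    by move: xm; rewrite x0 mxE normr0 ltr10.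
  by rewrite mulr1 ltW// (lt_le_trans xc)// bigmin_le.
by rewrite ltxx.
Qed.

Lemma qball1_lty : (lebesgue_rV N.+1 (qball nrm 1) < +oo)%E.
Proof.
have [c c0 cbox] := qball_bounded.
pose cube := [set x : 'rV[R]_N.+1 | forall i, `[-1, 1]%classic (x ord0 i)].
have boxoo : (lebesgue_rV N.+1 cube < +oo)%E.
  rewrite (@lebesgue_rV_box R N.+1 (fun=> `[-1, 1]%classic))// (eq_bigr (fun=> (1 + 1)%:E)).
    by rewrite prodEFin ltry.
  by move=> i _; rewrite lebesgue_measure_itv/= lte_fin ifT -?EFinB ?opprK//; lra.
have : (lebesgue_rV N.+1 (qball nrm c) < +oo)%E.
  apply: le_lt_trans boxoo; apply: le_measure => //; rewrite inE.
  - exact: measurable_qball.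
  - exact: (@measurable_box _ _ (fun=> `[-1, 1]%classic)).
rewrite qballZ// => h; rewrite ltey; apply: contraTN h => /eqP ->.
by rewrite gt0_muley ?lte_fin ?powR_gt0.
Qed.

(** Otherwise all balls would be null, and they cover the space. *)
Lemma qball1_gt0 : (0 < lebesgue_rV N.+1 (qball nrm 1))%E.
Proof.
rewrite lt0e measure_ge0 andbT; apply/eqP => z.
have qn0 (k : nat) : lebesgue_rV N.+1 (qball nrm k.+1%:R) = 0%E.
  by rewrite qballZ// z mule0.
pose cube := [set x : 'rV[R]_N.+1 | forall i, `[0, 1]%classic (x ord0 i)].
have : (lebesgue_rV N.+1 cube <= 0)%E.
  apply: (le_trans (measure_sigma_subadditive (lebesgue_rV N.+1)
    (F := fun k => qball nrm k.+1%:R) (fun k => measurable_qball _) _ _)).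
  - exact: (@measurable_box _ _ (fun=> `[0, 1]%classic)).
  - move=> x _; exists (Num.bound (nrm x)) => //; rewrite /qball/=.
    by apply: (lt_trans (archi_boundP (qn_ge0 nrm x))); rewrite ltr_nat.
  by rewrite eseries0// => k _ _; exact: qn0.
rewrite (@lebesgue_rV_box R N.+1 (fun=> `[0, 1]%classic))// (eq_bigr (fun=> 1%:E)); last first.
  by move=> i _; rewrite lebesgue_measure_itv/= lte_fin ltr01 -EFinB subr0.
by rewrite prodEFin big1// lee_fin ler10.
Qed.

(** The volume of the unit quasi-ball, the quotient of the total mass of the
unit sphere by Q. *)
Definition qomega : R := fine (lebesgue_rV N.+1 (qball nrm 1)).

Lemma qomegaE : lebesgue_rV N.+1 (qball nrm 1) = qomega%:E.
Proof. by rewrite /qomega fineK// ge0_fin_numE// qball1_lty. Qed.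

Lemma qomega_gt0 : 0 < qomega.
Proof. by rewrite -lte_fin -qomegaE qball1_gt0. Qed.

Lemma qvolE r : 0 <= r -> qvol nrm r = qomega * r `^ Q.
Proof.
rewrite le_eqVlt => /predU1P[<-|r0].
  rewrite /qvol (_ : qball nrm 0 = set0) ?measure0.
    by rewrite powR0 ?mulr0// gt_eqF// hdim_gt0.
  by apply/seteqP; split => // x; rewrite /qball/= ltNge qn_ge0.
by rewrite /qvol qballZ// qomegaE/= mulrC.
Qed.

End quasi_ball.

(** * Directions and the volume gauge *)

Section polar.
Context {R : realType} (N : nat) (G : homogeneous_group R N.+1).
Variable nrm : quasi_norm G.

Local Notation mu := (lebesgue_rV N.+1 : {sigma_finite_measure set 'rV[R]_N.+1 -> \bar R}).
Local Notation V := 'rV[R]_N.+1.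
Local Notation w := (hg_wt G).
Local Notation Q := (hdim G).
Local Notation dil := (dilation w).
Local Notation om := (qomega nrm).

Definition gauge (x : V) : R := qvol nrm (nrm x).

Definition direction (x : V) : V := dil (nrm x)^-1 x.

Lemma gaugeE x : gauge x = om * nrm x `^ Q.
Proof. by rewrite /gauge qvolE// qn_ge0. Qed.

Lemma measurable_gauge : measurable_fun setT gauge.
Proof.
rewrite (_ : gauge = (fun x => om * nrm x `^ Q)); last exact/funext/gaugeE.
apply: measurable_funM => //.
exact: (measurableT_comp (measurable_powR _) (measurable_qn nrm)).
Qed.

Lemma gauge_gt0 x : (0 < gauge x) = (x != 0).
Proof.
rewrite gaugeE pmulr_rgt0 ?qomega_gt0// -(qn_gt0 nrm).
have [x0|] := ltP 0 (nrm x); first by rewrite powR_gt0.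
by move=> x0; rewrite (_ : nrm x = 0) ?powR0 ?ltxx ?gt_eqF ?hdim_gt0//;
  apply/eqP; rewrite eq_le x0 qn_ge0.
Qed.

Lemma qnE x : nrm x = (gauge x / om) `^ Q^-1.
Proof.
rewrite gaugeE mulrAC mulfV ?gt_eqF ?qomega_gt0// mul1r -powRrM mulfV ?gt_eqF ?hdim_gt0//.
by rewrite powRr1// qn_ge0.
Qed.

Lemma gauge_le x t : 0 <= t -> (gauge x <= t) = (nrm x <= (t / om) `^ Q^-1).
Proof.
move=> t0; have o0 := qomega_gt0 nrm; have Q0 := hdim_gt0 G.
have s0 : 0 <= t / om by rewrite divr_ge0// ltW.
rewrite gaugeE mulrC -ler_pdivlMr//.
have {1}-> : t / om = ((t / om) `^ Q^-1) `^ Q.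
  by rewrite -powRrM mulVf ?gt_eqF// powRr1.
apply/idP/idP => h; last first.
  by rewrite ge0_ler_powR ?nnegrE ?qn_ge0 ?powR_ge0 ?(ltW Q0).
rewrite leNgt; apply/negP => /(gt0_ltr_powR Q0); rewrite !nnegrE qn_ge0 powR_ge0.
by move=> /(_ isT isT); rewrite ltNge h.
Qed.

Lemma measurable_direction : measurable_fun setT direction.
Proof.
have -> : direction = (fun z => dil z.1 z.2) \o (fun x : V => ((nrm x) `^ (-1), x)).
  by apply/funext => x; rewrite /= /direction powR_inv1// qn_ge0.
apply: measurableT_comp; first exact: measurable_dilation2.
apply: measurable_fun_pair => //.
exact: (measurableT_comp (measurable_powR _) (measurable_qn nrm)).
Qed.

Lemma qn_direction x : x != 0 -> nrm (direction x) = 1.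
Proof.
by move=> x0; rewrite /direction qnZ ?invr_gt0 ?qn_gt0// mulVf// gt_eqF// qn_gt0.
Qed.

Lemma dilation_direction x : x != 0 -> dil (nrm x) (direction x) = x.
Proof.
move=> x0; rewrite /direction dilationM ?invr_ge0 ?qn_ge0// mulfV ?dilation1//.
by rewrite gt_eqF// qn_gt0.
Qed.

Lemma direction_dilation c x : 0 < c -> direction (dil c x) = direction x.
Proof.
move=> c0; rewrite /direction qnZ// dilationM ?invr_ge0 ?mulr_ge0 ?qn_ge0 ?(ltW c0)//.
congr (dil _ x); have [->|x0] := eqVneq (nrm x) 0.
  by rewrite mulr0 !invr0 mul0r.
by field; rewrite x0 gt_eqF.
Qed.

Lemma measurable_rV0 : measurable [set (0 : V)].
Proof.
rewrite (_ : [set 0] = [set x : V | forall i, [set (0 : R)] (x ord0 i)]).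
  exact: (@measurable_box _ _ (fun=> [set 0])).
apply/seteqP; split => x /=; first by move=> -> i; rewrite mxE.
by move=> h; apply/rowP => i; rewrite h mxE.
Qed.

Let U : set V := [set x | 0 < nrm x <= 1].

Lemma measurable_punctured_unit_ball : measurable [set x : V | 0 < nrm x <= 1].
Proof.
rewrite (_ : mkset _ = [set x | 0 < nrm x] `&` [set x | nrm x <= 1]); last first.
  by apply/seteqP; split => x /=; [move=> /andP[]|move=> [h1 h2]; apply/andP].
apply: measurableI; first by apply: measurable_set_lt => //; exact: measurable_qn.
by apply: measurable_set_le => //; exact: measurable_qn.
Qed.

Let mU : measurable U. Proof. exact: measurable_punctured_unit_ball. Qed.

Let mdirE E : measurable E -> measurable (direction @^-1` E).
Proof. by move=> mE; rewrite -[X in measurable X]setTI; exact: measurable_direction. Qed.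

(** The cone over E is invariant under dilations, so the part inside a ball is
a dilate of the part inside the unit ball. *)
Lemma cone_dilation E t : measurable E -> 0 < t ->
  mu (direction @^-1` E `&` sublevel gauge t) = ((t / om)%:E * mu (direction @^-1` E `&` U))%E.
Proof.
move=> mE t0; have o0 := qomega_gt0 nrm; have Q0 := hdim_gt0 G.
pose r := (t / om) `^ Q^-1.
have r0 : 0 < r by rewrite powR_gt0// divr_gt0.
have ri0 : 0 < r^-1 by rewrite invr_gt0.
have -> : direction @^-1` E `&` sublevel gauge t = dil r^-1 @^-1` (direction @^-1` E `&` U).
  apply/seteqP; split => x; rewrite /sublevel /U /= direction_dilation// gauge_gt0;
    rewrite gauge_le ?(ltW t0)// -(qn_gt0 nrm) qnZ//.
    move=> [Ex [x0 xr]]; split => //; rewrite mulr_gt0//= mulrC ler_pdivrMr// mul1r //.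
  move=> [Ex /andP[]]; rewrite pmulr_rgt0// => x0.
  by rewrite mulrC ler_pdivrMr// mul1r.
rewrite lebesgue_rV_dilation//; last by apply: measurableI => //; exact: mdirE.
congr ((_%:E) * _)%E; rewrite -[r^-1]powR_inv1 ?(ltW r0)// -powRrM mulN1r opprK.
by rewrite -powRrM mulVf ?gt_eqF// powRr1// divr_ge0 ?ltW.
Qed.

(** The closed ball lies in every larger open ball, whose volume is continuous
in the radius; the centre is a null set. *)
Lemma measure_unit_ball : mu U = om%:E.
Proof.
have o0 := qomega_gt0 nrm; have Q0 := hdim_gt0 G.
have mq := measurable_qball nrm.
have le1 (d : R) : 0 < d -> (mu U <= (om * expR d)%:E)%E.
  move=> d0; have r0 : 0 < expR (d / Q) by rewrite expR_gt0.
  have -> : (om * expR d)%:E = mu (qball nrm (expR (d / Q))).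
    rewrite qballZ// qomegaE -EFinM mulrC /powR gt_eqF ?expR_gt0// expRK.
    by congr (expR _ * _)%:E; field; rewrite gt_eqF.
  apply: le_measure; rewrite ?inE//.
  move=> x /andP[_ x1]; rewrite /qball/=; apply: le_lt_trans x1 _.
  by rewrite expR_gt1 divr_gt0.
have Ufin : exists a, mu U = a%:E.
  exists (fine (mu U)); rewrite fineK// ge0_fin_numE//.
  exact: le_lt_trans (le1 1 ltr01) (ltry _).
have [a aE] := Ufin.
apply/eqP; rewrite eq_le; apply/andP; split.
  rewrite aE lee_fin leNgt; apply/negP => oa.
  have a0 : 0 < a by exact: lt_trans oa.
  (* half of the logarithmic excess already contradicts the bound *)
  have l0 : 0 < ln (a / om) by rewrite ln_gt0// ltr_pdivlMr// mul1r.
  have := le1 (ln (a / om) / 2) (divr_gt0 l0 (ltr0Sn R 1)).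
  rewrite aE lee_fin mulrC -ler_pdivrMr// -[leLHS]lnK ?posrE ?divr_gt0// ler_expR.
  lra.
rewrite -qomegaE; have -> : qball nrm 1 = [set 0] `|` (qball nrm 1 `&` U).
  apply/seteqP; split => x; rewrite /qball /U /=.
    move=> x1; have [->|x0] := eqVneq x 0; [by left|right].
    by rewrite qn_gt0 x0 x1 ltW.
  by move=> [->|[]//]; rewrite (qn_eq0 nrm 0).2.
apply: (le_trans (measureU2 _ _ _)) => //; first exact: measurable_rV0.
  exact: measurableI.
rewrite [X in (X + _ <= _)%E]lebesgue_rV_set0 add0e; apply: le_measure; rewrite ?inE//.
exact: measurableI.
Qed.

End polar.

(** * The change of variables s |-> s^(-1/eps) *)

Section radial_change_of_variables.
Context {R : realType} (N : nat) (G : homogeneous_group R N.+1).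
Variable nrm : quasi_norm G.

Local Notation mu := (lebesgue_rV N.+1 : {sigma_finite_measure set 'rV[R]_N.+1 -> \bar R}).
Local Notation V := 'rV[R]_N.+1.
Local Notation w := (hg_wt G).
Local Notation Q := (hdim G).
Local Notation dil := (dilation w).
Local Notation om := (qomega nrm).
Local Notation b := (gauge nrm).
Local Notation dir := (direction nrm).

Let o0 : 0 < om. Proof. exact: qomega_gt0. Qed.
Let Q0 : 0 < Q. Proof. exact: hdim_gt0. Qed.

(** The proportion of the volume of a ball taken by the cone over E, that is,
the normalized surface measure of E. *)
Definition cone_density (E : set V) : R :=
  fine (mu (dir @^-1` E `&` [set x | 0 < nrm x <= 1])) / om.

Let mdirE E : measurable E -> measurable (dir @^-1` E).
Proof. by move=> mE; rewrite -[X in measurable X]setTI; exact: measurable_direction. Qed.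

Let sublevel0 : sublevel b 0 = set0.
Proof. by apply/seteqP; split => // x [/lt_le_trans h /h]; rewrite ltxx. Qed.

Lemma cone_density_ge0 E : 0 <= cone_density E.
Proof. by rewrite divr_ge0 ?(ltW o0)// fine_ge0. Qed.

Lemma measure_cone E t : measurable E -> 0 <= t ->
  mu (dir @^-1` E `&` sublevel b t) = (cone_density E * t)%:E.
Proof.
move=> mE; rewrite le_eqVlt => /predU1P[<-|t0].
  by rewrite mulr0 sublevel0 setI0 measure0.
rewrite cone_dilation// /cone_density; set m := mu _.
have mfin : m \is a fin_num.
  rewrite ge0_fin_numE ?measure_ge0//; apply: (@le_lt_trans _ _ om%:E); last exact: ltry.
  have mU := measure_unit_ball nrm; rewrite -mU; apply: le_measure; rewrite ?inE.
  - apply: measurableI; first exact: mdirE.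
    exact: measurable_punctured_unit_ball.
  - exact: measurable_punctured_unit_ball.
  - by apply: subIset; right.
rewrite -[in LHS](fineK mfin) -EFinM; congr EFin.
by field; rewrite gt_eqF.
Qed.

Lemma cone_densityT : cone_density setT = 1.
Proof.
rewrite /cone_density preimage_setT setTI.
have -> : fine (mu [set x | 0 < nrm x <= 1]) = om by rewrite measure_unit_ball.
by rewrite mulfV ?gt_eqF.
Qed.

Lemma measure_gauge_ball t : 0 <= t -> mu (sublevel b t) = t%:E.
Proof.
by move=> t0; have := measure_cone measurableT t0; rewrite preimage_setT setTI cone_densityT mul1r.
Qed.

Variable eps : R.
Hypothesis e0 : 0 < eps.

Local Notation phi := (fun s : V => radial_pow nrm s (- eps^-1)).

(** The Jacobian of s |-> s^(-1/eps), in the form in which it occurs in the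
tilde weights. *)
Definition radial_jac (s : V) : R := eps^-1 * nrm s `^ (- (Q * (1 + eps^-1))).

Local Notation J := radial_jac.

Lemma radial_powE a s : radial_pow nrm s a = dil (nrm s `^ a) (dir s).
Proof. by []. Qed.

Lemma measurable_radial_pow a : measurable_fun setT (fun s : V => radial_pow nrm s a).
Proof.
have -> : (fun s => radial_pow nrm s a) =
    (fun z => dil z.1 z.2) \o (fun x : V => ((nrm x) `^ a, dir x)) by [].
apply: measurableT_comp; first exact: measurable_dilation2.
apply: measurable_fun_pair; last exact: measurable_direction.
exact: (measurableT_comp (measurable_powR _) (measurable_qn nrm)).
Qed.

Lemma qn_radial_pow a s : s != 0 -> nrm (radial_pow nrm s a) = nrm s `^ a.
Proof.
by move=> s0; rewrite radial_powE qnZ ?powR_gt0 ?qn_gt0// qn_direction// mulr1.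
Qed.

Lemma direction_radial_pow a s : s != 0 -> dir (radial_pow nrm s a) = dir s.
Proof.
move=> s0; rewrite radial_powE direction_dilation ?powR_gt0 ?qn_gt0//.
by rewrite direction_dilation// invr_gt0 qn_gt0.
Qed.

Lemma radial_pow0 a : radial_pow nrm 0 a = 0.
Proof. by rewrite radial_powE /direction; apply/rowP => i; rewrite !mxE !mulr0. Qed.

Lemma radial_pow_eq0 a s : (radial_pow nrm s a == 0) = (s == 0).
Proof.
have [->|s0] := eqVneq s 0; first by rewrite radial_pow0 eqxx.
apply/negbTE; rewrite -(qn_gt0 nrm) qn_radial_pow// powR_gt0// qn_gt0//.
Qed.

Lemma gauge_radial_pow a s : s != 0 -> b (radial_pow nrm s a) = om * (b s / om) `^ a.
Proof.
move=> s0; rewrite gaugeE qn_radial_pow// gaugeE mulrAC mulfV ?gt_eqF// mul1r.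
by rewrite -!powRrM [a * _]mulrC.
Qed.

Lemma radial_jacE s : J s = eps^-1 * (b s / om) `^ (- (1 + eps^-1)).
Proof.
rewrite /radial_jac gaugeE mulrAC mulfV ?gt_eqF// mul1r -powRrM.
by congr (_ * _ `^ _); ring.
Qed.

Lemma radial_jac_ge0 s : 0 <= J s.
Proof. by rewrite mulr_ge0 ?powR_ge0// invr_ge0 ltW. Qed.

Lemma measurable_radial_jac : measurable_fun setT J.
Proof.
apply: measurable_funM => //.
exact: (measurableT_comp (measurable_powR _) (measurable_qn nrm)).
Qed.

Let nu := weighted_image mu measurable_radial_jac (measurable_radial_pow (- eps^-1)).

Lemma radial_ball t s : 0 < t ->
  sublevel b t (phi s) <-> om * (t / om) `^ (- eps) <= b s.
Proof.
move=> t0; have t1 : 0 < t / om by rewrite divr_gt0.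
have T0 : 0 < om * (t / om) `^ (- eps) by rewrite mulr_gt0 ?powR_gt0.
have [->|s0] := eqVneq s 0.
  rewrite radial_pow0 /sublevel /=; split => [[]|].
    by rewrite gauge_gt0 eqxx.
  by move=> /(lt_le_trans T0); rewrite gauge_gt0 eqxx.
have bs : 0 < b s by rewrite gauge_gt0.
rewrite /sublevel /= gauge_radial_pow//.
have bo : 0 < b s / om by rewrite divr_gt0.
have -> : (om * (t / om) `^ (- eps) <= b s) = (om * (b s / om) `^ (- eps^-1) <= t).
  rewrite [om * (t / om) `^ _]mulrC [om * (b s / om) `^ _]mulrC -!ler_pdivlMr//.
  rewrite -[LHS]ler_ln ?posrE ?powR_gt0// -[RHS]ler_ln ?posrE ?powR_gt0// !ln_powR.
  by rewrite [in RHS]mulNr -[in RHS]mulrN ler_pdivrMl// mulNr lerNl.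
split => [[]//|h]; split => //.
by rewrite mulr_gt0 ?powR_gt0.
Qed.

Lemma measure_cone_radial E t : measurable E -> 0 <= t ->
  nu (dir @^-1` E `&` sublevel b t) = (cone_density E * t)%:E.
Proof.
move=> mE; rewrite le_eqVlt => /predU1P[<-|t0].
  by rewrite mulr0 sublevel0 setI0 measure0.
have ei0 : 0 < eps^-1 by rewrite invr_gt0.
have t1 : 0 < t / om by rewrite divr_gt0.
have mb := measurable_gauge nrm.
rewrite /nu weighted_imageE; last first.
- by apply: measurableI; [exact: mdirE|exact: measurable_sublevel].
- exact: radial_jac_ge0.
(* phi reverses radii: b (phi s) <= t means tau <= b s *)
set tau := om * (t / om) `^ (- eps).
have tau0 : 0 < tau by rewrite mulr_gt0 ?powR_gt0.
have -> : phi @^-1` (dir @^-1` E `&` sublevel b t) =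
    dir @^-1` E `&` [set s | tau <= b s].
  apply/seteqP; split => s /= [h1 h2].
    have := radial_ball s t0; move=> [/(_ h2) h3 _]; split => //.
    have s0 : s != 0 by rewrite -(gauge_gt0 nrm); exact: lt_le_trans h3.
    by rewrite direction_radial_pow in h1.
  have s0 : s != 0 by rewrite -(gauge_gt0 nrm); exact: lt_le_trans h2.
  by split; [rewrite direction_radial_pow|exact/radial_ball].
have jE s : tau <= b s ->
    J s = eps^-1 * om `^ (1 + eps^-1) * b s `^ (- eps^-1 - 1).
  move=> /(lt_le_trans tau0) bs; rewrite radial_jacE powRM ?invr_ge0 ?(ltW o0) ?(ltW bs)//.
  rewrite -[om^-1]powR_inv1 ?(ltW o0)// -powRrM mulN1r opprK.
  by rewrite opprD [-1 - eps^-1]addrC [in RHS]mulrAC mulrA.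
rewrite (eq_integral (fun s => (eps^-1 * om `^ (1 + eps^-1))%:E *
    (b s `^ (- eps^-1 - 1))%:E)%E); last first.
  by move=> s /set_mem[_ h]; rewrite -EFinM (jE s h).
rewrite ge0_integralZl//; last 4 first.
- by apply: measurableI; [exact: mdirE|exact: measurable_set_le].
- apply/measurable_EFinP; apply: measurable_funTS.
  exact: (measurableT_comp (measurable_powR _) mb).
- by move=> s _; rewrite lee_fin powR_ge0.
- by rewrite lee_fin mulr_ge0 ?powR_ge0// ltW.
rewrite (@integral_cone_powRN _ _ _ mu b mb _ _ (mdirE mE) (cone_density_ge0 E))//; last first.
  by move=> s; exact: measure_cone.
rewrite -EFinM; congr EFin; rewrite invrK.
have -> : tau `^ (- eps^-1) = om `^ (- eps^-1) * (t / om).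
  rewrite /tau powRM ?powR_ge0 ?(ltW o0)// -powRrM mulrNN mulfV ?gt_eqF// powRr1//.
  exact: ltW.
have -> : om `^ (1 + eps^-1) = om * om `^ eps^-1.
  by rewrite powRD ?powRr1 ?(ltW o0)// (gt_eqF o0) implybT.
rewrite powRN; field.
by rewrite !gt_eqF ?powR_gt0.
Qed.

Lemma pos_setE : pos_set b = [set x : V | x != 0].
Proof. by apply/seteqP; split => x; rewrite /pos_set/= gauge_gt0. Qed.

(** Both measures give c(E) t to the part of a cone where b <= t. *)
Lemma radial_measureE A : measurable A -> A `<=` pos_set b -> nu A = mu A.
Proof.
pose point (z : R * V) := dil ((z.1 / om) `^ Q^-1) z.2.
have mpoint : measurable_fun setT point.
  have -> : point = (fun z => dil z.1 z.2) \o
      (fun z : R * V => ((z.1 / om) `^ Q^-1, z.2)) by [].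
  apply: measurableT_comp; first exact: measurable_dilation2.
  have m1 : measurable_fun setT (fun z : R * V => z.1 / om).
    by apply: measurable_funM; [exact: measurable_fst|exact: measurable_cst].
  apply: measurable_fun_pair; last exact: measurable_snd.
  exact: (measurableT_comp (measurable_powR _) m1).
apply: (@polar_measure_unique _ V R nu mu b dir point cone_density) => //.
- exact: measurable_gauge.
- exact: measurable_direction.
- move=> x; rewrite gauge_gt0 => x0; rewrite /point /= -qnE dilation_direction//.
- exact: cone_density_ge0.
- exact: measure_cone_radial.
- exact: measure_cone.
Qed.

Lemma ge0_integral_radial (D : set V) (h : V -> \bar R) : measurable D ->
  D `<=` pos_set b -> measurable_fun D h -> (forall y, D y -> 0 <= h y)%E ->
  (\int[mu]_(y in D) h y = \int[mu]_(s in phi @^-1` D) (h (phi s) * (J s)%:E))%E.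
Proof.
move=> mD Db mh h0.
have -> : (\int[mu]_(y in D) h y = \int[nu]_(y in D) h y)%E.
  apply: eq_measure_integral => A mA AD; apply/esym/radial_measureE => //.
  exact: subset_trans AD Db.
rewrite integral_mkcond ge0_integral_weighted_image//; last first.
- by move=> y; rewrite patchE; case: ifPn => // /set_mem; exact: h0.
- exact: (proj1 (measurable_restrictT _ mD)).
- exact: radial_jac_ge0.
rewrite [RHS]integral_mkcond; apply: eq_integral => s _; rewrite !patchE.
have -> : (s \in phi @^-1` D) = (phi s \in D) by apply/idP/idP; rewrite !inE.
by case: ifPn => // _; rewrite mul0e.
Qed.

End radial_change_of_variables.

(** * The operator in the new variable *)

Lemma measurable_expeR (R : realType) : measurable_fun [set: \bar R] (@expeR R).
Proof.
rewrite (_ : @expeR R = fun x => if x == -oo%E then 0%E else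
    if x == +oo%E then +oo%E else (expR (fine x))%:E); last first.
  by apply/funext => -[].
apply: measurable_fun_ifT => //; first exact: measurable_fun_eqe.
apply: measurable_fun_ifT => //; first exact: measurable_fun_eqe.
apply/measurable_EFinP; apply: measurableT_comp => //.
Qed.

Section hardy_in_radial_coordinates.
Context {R : realType} (N : nat) (G : homogeneous_group R N.+1).
Variable nrm : quasi_norm G.

Local Notation mu := (lebesgue_rV N.+1 : {sigma_finite_measure set 'rV[R]_N.+1 -> \bar R}).
Local Notation V := 'rV[R]_N.+1.
Local Notation Q := (hdim G).
Local Notation om := (qomega nrm).
Local Notation b := (gauge nrm).

Variable eps : R.
Hypothesis e0 : 0 < eps.

Local Notation phi := (fun s : V => radial_pow nrm s (- eps^-1)).
Local Notation J := (radial_jac nrm eps).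

Let o0 : 0 < om. Proof. exact: qomega_gt0. Qed.
Let mb : measurable_fun setT b. Proof. exact: measurable_gauge. Qed.
Let mphi : measurable_fun setT phi. Proof. exact: measurable_radial_pow. Qed.
Let mJ : measurable_fun setT J. Proof. exact: measurable_radial_jac. Qed.

Lemma ge0_integral_pos_set (h : V -> \bar R) : measurable_fun setT h ->
  (forall x, 0 <= h x)%E -> (\int[mu]_x h x = \int[mu]_(x in pos_set b) h x)%E.
Proof.
move=> mh h0; rewrite (@ge0_negligible_integral _ _ _ mu setT [set 0])//; last 2 first.
- exact: measurable_rV0.
- exact: lebesgue_rV_set0.
by congr (integral _ _ _); rewrite pos_setE; apply/seteqP; split => x /=; [case=> _ /eqP|move=> /eqP].
Qed.

Lemma pos_set_radial : phi @^-1` pos_set b = pos_set b.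
Proof. by apply/seteqP; split => x; rewrite /= pos_setE /= radial_pow_eq0. Qed.

Lemma ge0_integral_radialT (h : V -> \bar R) : measurable_fun setT h ->
  (forall x, 0 <= h x)%E ->
  (\int[mu]_x h x = \int[mu]_(s in pos_set b) (h (phi s) * (J s)%:E))%E.
Proof.
move=> mh h0; rewrite (ge0_integral_pos_set mh h0) -[in RHS]pos_set_radial.
apply: ge0_integral_radial => //; first exact: measurable_pos_set.
exact: measurable_funTS.
Qed.

Lemma tildeE (u : V -> R) s : tilde nrm eps u s = u (phi s) * J s.
Proof. by rewrite /tilde /radial_jac mulrA. Qed.

Lemma measurable_tilde (u : V -> R) : measurable_fun setT u ->
  measurable_fun setT (tilde nrm eps u).
Proof.
move=> mu_; rewrite (_ : tilde _ _ _ = fun s => u (phi s) * J s); last exact/funext/tildeE.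
by apply: measurable_funM => //; exact: measurableT_comp.
Qed.

Lemma radial_jac_gt0 s : pos_set b s -> 0 < J s.
Proof.
rewrite pos_setE => s0; rewrite mulr_gt0 ?invr_gt0 ?powR_gt0// qn_gt0//.
Qed.

Lemma tilde_gt0 (u : V -> R) s : (forall x, 0 < u x) -> pos_set b s -> 0 < tilde nrm eps u s.
Proof. by move=> u0 bs; rewrite tildeE mulr_gt0 ?radial_jac_gt0. Qed.

Lemma radial_complement_ball t : pos_set b t ->
  phi @^-1` (~` qball nrm (nrm (phi t))) = sublevel b (b t).
Proof.
rewrite pos_setE => t0; have nt0 : 0 < nrm t by rewrite qn_gt0.
have ei0 : 0 < eps^-1 by rewrite invr_gt0.
apply/seteqP; split => s; rewrite /qball /sublevel /=; have [->|s0] := eqVneq s 0.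
- rewrite radial_pow0 (qn_eq0 nrm 0).2// qn_radial_pow// => h.
  by exfalso; apply: h; rewrite powR_gt0.
- rewrite !qn_radial_pow// => /negP; rewrite -leNgt !powRN.
  rewrite lef_pV2 ?posrE ?powR_gt0 ?qn_gt0// => h.
  rewrite gauge_gt0 s0 gauge_le ?gaugeE ?mulr_ge0 ?powR_ge0 ?(ltW o0)// -gaugeE -qnE; split => //.
  rewrite leNgt; apply/negP => /(gt0_ltr_powR ei0).
  by rewrite !nnegrE !qn_ge0 => /(_ isT isT); rewrite ltNge h.
- by rewrite gauge_gt0 eqxx => -[].
move=> [_]; rewrite gauge_le ?gaugeE ?mulr_ge0 ?powR_ge0 ?(ltW o0)// -gaugeE -qnE => st.
rewrite !qn_radial_pow//; apply/negP; rewrite -leNgt !powRN.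
rewrite lef_pV2 ?posrE ?powR_gt0 ?qn_gt0//.
by rewrite ge0_ler_powR ?nnegrE ?qn_ge0// ltW.
Qed.

(** The exponents are such that the kernel of the operator and the Jacobian
cancel up to a constant. *)
Lemma gauge_radial_jac s : pos_set b s ->
  b (phi s) `^ (- eps - 1) * J s = eps^-1 * om `^ (- eps - 1).
Proof.
move=> bs; have s0 : s != 0 by move: bs; rewrite pos_setE.
have bo : 0 < b s / om by rewrite divr_gt0.
rewrite gauge_radial_pow// radial_jacE powRM ?powR_ge0 ?(ltW o0)// -powRrM.
have -> : - eps^-1 * (- eps - 1) = 1 + eps^-1 by field; rewrite gt_eqF.
rewrite powRN; field; rewrite !gt_eqF ?powR_gt0//.
Qed.

Lemma gauge_radial_eps t : pos_set b t ->
  eps * b (phi t) `^ eps * (eps^-1 * om `^ (- eps - 1)) = (b t)^-1.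
Proof.
move=> bt; have t0 : t != 0 by move: bt; rewrite pos_setE.
have bo : 0 < b t / om by rewrite divr_gt0.
rewrite gauge_radial_pow// powRM ?powR_ge0 ?(ltW o0)// -powRrM mulNr mulVf ?gt_eqF//.
rewrite -opprD [om `^ (- _)]powRN powRD ?powRr1 ?(ltW o0)//; last first.
  by rewrite (gt_eqF o0) implybT.
rewrite powR_inv1 ?(ltW bo)//; field.
by rewrite !gt_eqF ?powR_gt0.
Qed.

(** The change of variables applies to the positive and the negative part
separately, so the identity includes the cases where the integrals are
infinite. *)
Lemma geom_mean_op_radial (f : V -> R) t : measurable_fun setT f -> pos_set b t ->
  geom_mean_op nrm eps f (phi t) =
  expeR ((b t)^-1%:E * \int[mu]_(s in sublevel b (b t)) (ln (f (phi s)))%:E)%E.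
Proof.
move=> mf bt; rewrite /geom_mean_op; congr expeR.
set D := ~` qball nrm (nrm (phi t)).
pose kap := eps^-1 * om `^ (- eps - 1).
have kap0 : 0 < kap by rewrite mulr_gt0 ?invr_gt0 ?powR_gt0.
have mD : measurable D by apply: measurableC; exact: measurable_qball.
have Db : D `<=` pos_set b.
  move=> y; rewrite /D /qball /= => /negP; rewrite -leNgt => h.
  rewrite /pos_set /= gauge_gt0 -(qn_gt0 nrm); apply: lt_le_trans h.
  by rewrite qn_gt0 radial_pow_eq0; move: bt; rewrite pos_setE.
pose k y := b y `^ (- eps - 1) * ln (f y).
have mk : measurable_fun setT k.
  apply: measurable_funM; first exact: (measurableT_comp (measurable_powR _) mb).
  exact: measurableT_comp.
have mlf : measurable_fun setT (fun s => ln (f (phi s))).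
  by apply: measurableT_comp => //; exact: measurableT_comp.
pose l s := ln (f (phi s)).
have kE s : pos_set b s -> k (phi s) * J s = kap * l s.
  by move=> bs; rewrite /k mulrAC gauge_radial_jac.
have mB : measurable (sublevel b (b t)) by exact: measurable_sublevel.
have part (K L : V -> R) : measurable_fun setT K -> measurable_fun setT L ->
    (forall y, 0 <= K y) -> (forall y, 0 <= L y) ->
    (forall s, pos_set b s -> K (phi s) * J s = kap * L s) ->
    (\int[mu]_(y in D) (K y)%:E = kap%:E * \int[mu]_(s in sublevel b (b t)) (L s)%:E)%E.
  move=> mK mL K0 L0 KL; rewrite (ge0_integral_radial (nrm := nrm) e0 mD Db); last 2 first.
  - by apply/measurable_EFinP; exact: measurable_funTS.
  - by move=> y _; rewrite lee_fin.
  rewrite radial_complement_ball// -ge0_integralZl//; last 3 first.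
  - by apply/measurable_EFinP; exact: measurable_funTS.
  - by move=> y _; rewrite lee_fin.
  - by rewrite lee_fin ltW.
  by apply: eq_integral => s /set_mem[bs _]; rewrite -!EFinM KL.
have Ip : (\int[mu]_(y in D) (EFin \o k)^\+ y =
    kap%:E * \int[mu]_(s in sublevel b (b t)) (EFin \o l)^\+ s)%E.
  rewrite !funerpos; apply: part.
  - exact: measurable_funrpos.
  - exact: measurable_funrpos.
  - by move=> y; rewrite /funrpos le_max lexx orbT.
  - by move=> y; rewrite /funrpos le_max lexx orbT.
  - move=> s bs; rewrite /funrpos mulrC maxr_pMr ?mulr0 ?radial_jac_ge0// mulrC kE//.
    by rewrite maxr_pMr ?mulr0 ?ltW.
have In : (\int[mu]_(y in D) (EFin \o k)^\- y =
    kap%:E * \int[mu]_(s in sublevel b (b t)) (EFin \o l)^\- s)%E.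
  rewrite !funerneg; apply: part.
  - exact: measurable_funrneg.
  - exact: measurable_funrneg.
  - by move=> y; rewrite /funrneg le_max lexx orbT.
  - by move=> y; rewrite /funrneg le_max lexx orbT.
  - move=> s bs; rewrite /funrneg mulrC maxr_pMr ?mulr0 ?radial_jac_ge0// mulrN mulrC kE//.
    by rewrite maxr_pMr ?mulr0 ?mulrN ?ltW.
have -> : (\int[mu]_(y in D) (qvol nrm (nrm y) `^ (- eps - 1) * ln (f y))%:E =
    kap%:E * \int[mu]_(s in sublevel b (b t)) (l s)%:E)%E.
  rewrite [LHS](_ : _ = \int[mu]_(y in D) ((EFin \o k) y))%E// integralE Ip In.
  rewrite [in RHS](_ : \int[mu]_(s in _) _ = \int[mu]_(s in sublevel b (b t)) ((EFin \o l) s))%E// [in RHS]integralE.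
  set P := (\int[mu]_(s in _) _^\+ s)%E; set M := (\int[mu]_(s in _) _^\- s)%E.
  have P0 : (0 <= P)%E by apply: integral_ge0.
  have M0 : (0 <= M)%E by apply: integral_ge0.
  case: P P0 => [x| |]// P0; case: M M0 => [y| |]// M0.
  - by rewrite -!EFinM mulrBr.
  - by rewrite gt0_muley ?lte_fin//= addeNy gt0_muleNy ?lte_fin.
  - by rewrite gt0_muley ?lte_fin//= gt0_muley ?lte_fin.
  - by rewrite gt0_muley ?lte_fin//= gt0_muleNy ?lte_fin.
by rewrite muleA -EFinM gauge_radial_eps.
Qed.

Lemma measurable_geom_mean_op (f : V -> R) : measurable_fun setT f ->
  measurable_fun setT (geom_mean_op nrm eps f).
Proof.
move=> mf; have mn := measurable_qn nrm.
pose B : set (V * V) := [set z | nrm z.1 <= nrm z.2].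
have mB : measurable B.
  apply: measurable_set_le.
    exact: (measurableT_comp mn measurable_fst).
  exact: (measurableT_comp mn measurable_snd).
pose k y := b y `^ (- eps - 1) * ln (f y).
have mk : measurable_fun setT k.
  apply: measurable_funM; first exact: (measurableT_comp (measurable_powR _) mb).
  exact: measurableT_comp.
have part (K : V -> R) : measurable_fun setT K -> (forall y, 0 <= K y) ->
    measurable_fun setT (fun x => \int[mu]_(y in ~` qball nrm (nrm x)) (K y)%:E)%E.
  move=> mK K0.
  have mF : measurable_fun setT (fun z : V * V => (\1_B z * K z.2)%:E).
    apply/measurable_EFinP; apply: measurable_funM; first exact: measurable_indic.
    exact: (measurableT_comp mK measurable_snd).
  have F0 z : (0 <= (\1_B z * K z.2)%:E)%E by rewrite lee_fin mulr_ge0.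
  have := @measurable_fun_fubini_tonelli_F _ _ V V R mu _ mF F0.
  apply: eq_measurable_fun => x _; rewrite /fubini_F [RHS]integral_mkcond.
  apply: eq_integral => y _; rewrite patchE indicE.
  have -> : ((x, y) \in B) = (y \in ~` qball nrm (nrm x)).
    apply/idP/idP => /set_mem h; apply/mem_set; move: h; rewrite /B /qball /=.
      by rewrite leNgt => /negP.
    by move=> /negP; rewrite -leNgt.
  by case: ifPn => _; rewrite ?mul1r ?mul0r.
rewrite /geom_mean_op; apply: (measurableT_comp (@measurable_expeR R)).
apply: emeasurable_funM.
  apply/measurable_EFinP; apply: measurable_funM => //.
  exact: (measurableT_comp (measurable_powR _) mb).
rewrite (_ : (fun x => _) = (fun x => \int[mu]_(y in ~` qball nrm (nrm x)) (EFin \o k)^\+ y -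
    \int[mu]_(y in ~` qball nrm (nrm x)) (EFin \o k)^\- y)%E); last first.
  by apply/funext => x; rewrite -integralE.
apply: emeasurable_funB.
  rewrite funerpos; apply: part; first exact: measurable_funrpos.
  by move=> y; rewrite /funrpos le_max lexx orbT.
rewrite funerneg; apply: part; first exact: measurable_funrneg.
by move=> y; rewrite /funrneg le_max lexx orbT.
Qed.

End hardy_in_radial_coordinates.

(** * The constant *)

Lemma powRN_le (R : realType) (a x y : R) : 0 < a -> 0 < x -> x <= y ->
  y `^ (- a) <= x `^ (- a).
Proof.
move=> a0 x0 xy; have y0 : 0 < y by exact: lt_le_trans xy.
rewrite !powRN lef_pV2 ?posrE ?powR_gt0//.
by rewrite ge0_ler_powR ?nnegrE// ltW.
Qed.

Section hardy_constant.
Context {R : realType} (N : nat) (G : homogeneous_group R N.+1).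
Variable nrm : quasi_norm G.

Local Notation mu := (lebesgue_rV N.+1 : {sigma_finite_measure set 'rV[R]_N.+1 -> \bar R}).
Local Notation V := 'rV[R]_N.+1.
Local Notation b := (gauge nrm).

Variables (u v : V -> R) (p q eps : R).
Hypotheses (wu : is_weight u) (wv : is_weight v).
Hypotheses (p0 : 0 < p) (pq : p <= q) (e0 : 0 < eps).

Local Notation phi := (fun s : V => radial_pow nrm s (- eps^-1)).
Local Notation J := (radial_jac nrm eps).
Local Notation K := ((p / q) `^ q^-1 * expR p^-1).

Let q0 : 0 < q. Proof. exact: lt_le_trans pq. Qed.
Let mb : measurable_fun setT b. Proof. exact: measurable_gauge. Qed.
Let mphi : measurable_fun setT phi. Proof. exact: measurable_radial_pow. Qed.
Let mball t : measurable (sublevel b t). Proof. exact: measurable_sublevel. Qed.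

(** The two sets differ by the sphere through x and by the point 0, which are
null sets. *)
Lemma integral_qball (F : V -> R) x : measurable_fun setT F -> pos_set b x ->
  (\int[mu]_(y in qball nrm (nrm x)) (F y)%:E =
   \int[mu]_(y in sublevel b (b x)) (F y)%:E)%E.
Proof.
move=> mF bx; rewrite integral_mkcond [RHS]integral_mkcond.
have mE : measurable_fun setT (fun y => (F y)%:E) by exact/measurable_EFinP.
apply: ae_eq_integral => //.
- apply: (proj1 (measurable_restrictT _ (measurable_qball nrm _))).
  exact: measurable_funTS.
- by apply: (proj1 (measurable_restrictT _ (mball _))); exact: measurable_funTS.
have msph : measurable [set y | b y = b x].
  by rewrite -[X in measurable X]setTI; exact: (mb measurableT (measurable_set1 (b x))).
exists ([set 0] `|` [set y | b y = b x]); split.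
- by apply: measurableU => //; exact: measurable_rV0.
- apply/eqP; rewrite eq_le measure_ge0 andbT.
  apply: (le_trans (measureU2 _ _ _)) => //; first exact: measurable_rV0.
  rewrite [X in (X + _ <= _)%E]lebesgue_rV_set0 add0e.
  by rewrite [leLHS](volume_sphere mb (measure_gauge_ball nrm) bx).
move=> y /= H; apply: contrapT => nH; apply: H => _; rewrite !patchE.
have [y0 yx] : y != 0 /\ b y != b x.
  split; apply/eqP => h; apply: nH; [by left|by right].
have -> // : (y \in qball nrm (nrm x)) = (y \in sublevel b (b x)).
have b0 : 0 <= b x by exact: ltW.
apply/idP/idP => /set_mem h; apply/mem_set; move: h; rewrite /qball /sublevel /=.
  by move=> /ltW h; rewrite gauge_gt0 y0 gauge_le// -qnE.
move=> [_ h]; rewrite lt_neqAle -[X in _ && X]andbT; move: (h); rewrite gauge_le// -qnE => -> /=.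
by rewrite andbT; apply: contra yx => /eqP; rewrite /gauge => ->.
Qed.

Lemma measurable_ln_tildeV : measurable_fun setT (fun y => ln (tilde nrm eps v y)^-1).
Proof.
have [mv v0] := wv; apply: measurableT_comp => //.
rewrite (_ : (fun y => _) = (fun y => tilde nrm eps v y `^ (-1))).
  exact: (measurableT_comp (measurable_powR _) (measurable_tilde nrm eps mv)).
apply/funext => y; rewrite powR_inv1// tildeE mulr_ge0 ?radial_jac_ge0//.
exact: ltW.
Qed.

Lemma hardy_ineq_Dtilde D : 0 < D -> (Dtilde nrm u v p q eps <= D%:E)%E ->
  hardy_ineq nrm u v p q eps (K * D).
Proof.
move=> D0 DD f mf f0; have [mu_ u0] := wu; have [mv v0] := wv.
have m1 : measurable_fun setT (fun x => geom_mean_op nrm eps f x `^ q * (u x)%:E)%E.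
  apply: emeasurable_funM; last exact/measurable_EFinP.
  apply: (measurableT_comp (measurable_poweR _)); exact: measurable_geom_mean_op.
have m2 : measurable_fun setT (fun x => (f x `^ p * v x)%:E).
  apply/measurable_EFinP; apply: measurable_funM => //.
  exact: (measurableT_comp (measurable_powR _) mf).
rewrite (ge0_integral_radialT nrm e0 m1); last first.
  by move=> x; rewrite mule_ge0 ?poweR_ge0// lee_fin ltW.
rewrite (ge0_integral_radialT nrm e0 m2); last first.
  by move=> x; rewrite lee_fin mulr_ge0 ?powR_ge0// ltW.
have := @hardy_on_volume _ V R mu b mb (measure_gauge_ball nrm)
  (tilde nrm eps u) (tilde nrm eps v) (fun s => f (phi s)) p q D
  (measurable_tilde nrm eps mv) (measurableT_comp mf mphi)
  (fun x bx => tilde_gt0 e0 u0 bx) (fun x bx => tilde_gt0 e0 v0 bx) (fun x _ => f0 _) p0 pq D0.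
rewrite [(D * _)%R]mulrC => H; rewrite (le_trans _ (le_trans (H _) _))//.
- rewrite le_eqVlt; apply/orP; left; apply/eqP; congr (_ `^ _)%E.
  apply: eq_integral => s /set_mem bs.
  by rewrite geom_mean_op_radial// -muleA -EFinM tildeE.
- move=> x bx; apply: le_trans DD; apply: ereal_sup_ubound; exists x.
    by move: bx; rewrite pos_setE.
  by rewrite (integral_qball measurable_ln_tildeV bx).
- rewrite le_eqVlt; apply/orP; left; apply/eqP; congr (_ * _ `^ _)%E.
  by apply: eq_integral => s /set_mem bs; rewrite -EFinM tildeE mulrA.
Qed.

(** A positive term of the supremum excludes the value -oo of its integral, and
finiteness of the supremum excludes +oo. *)
Lemma log_tilde_integrable x : (Dtilde nrm u v p q eps < +oo)%E ->
  pos_set b x ->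
  (0 < (qvol nrm (nrm x) `^ (q^-1 - p^-1) * tilde nrm eps u x `^ q^-1)%:E *
    expeR ((qvol nrm (nrm x))^-1%:E *
      \int[mu]_(y in qball nrm (nrm x)) (ln (tilde nrm eps v y)^-1)%:E) `^ p^-1)%E ->
  mu.-integrable (sublevel b (b x)) (EFin \o (fun y => ln (tilde nrm eps v y)^-1)).
Proof.
move=> Doo bx pos; have [_ u0] := wu.
have bx0 : 0 < qvol nrm (nrm x) by [].
have c0 : 0 < qvol nrm (nrm x) `^ (q^-1 - p^-1) * tilde nrm eps u x `^ q^-1.
  by rewrite mulr_gt0 ?powR_gt0// (tilde_gt0 e0 u0 bx).
have : ((qvol nrm (nrm x) `^ (q^-1 - p^-1) * tilde nrm eps u x `^ q^-1)%:E *
    expeR ((qvol nrm (nrm x))^-1%:E *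
      \int[mu]_(y in qball nrm (nrm x)) (ln (tilde nrm eps v y)^-1)%:E) `^ p^-1 < +oo)%E.
  apply: le_lt_trans Doo; apply: ereal_sup_ubound; exists x => //.
  by move: bx; rewrite pos_setE.
move: pos; rewrite (integral_qball measurable_ln_tildeV bx) => pos fin.
apply: integral_fin_integrable => //.
- by apply: measurable_funTS; exact: measurable_ln_tildeV.
- rewrite ltey; apply: contraTN fin => /eqP ->.
  rewrite gt0_muley ?lte_fin ?invr_gt0// [expeR _]/=.
  by rewrite poweRyr ?gt_eqF ?invr_gt0// gt0_muley ?lte_fin// ltxx.
- apply: integral_neg_lty; rewrite ltNye; apply: contraTN pos => /eqP ->.
  rewrite gt0_muleNy ?lte_fin ?invr_gt0//.
  by rewrite powR0 ?gt_eqF ?invr_gt0// mulr0 ltxx.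
Qed.

(** Take f^p v = max(b, T')^(-eps-1), which is integrable, where T' is the
value of b on the image of the sphere b = T under the substitution. In the new
variable f~^p v~ is then constant on the ball b <= T, where log v~ is
integrable for a suitable T; there the geometric means of f~ are positive. *)
Lemma Dtilde_test_function : (0 < Dtilde nrm u v p q eps)%E ->
  (Dtilde nrm u v p q eps < +oo)%E ->
  exists f : V -> R, [/\ measurable_fun setT f, forall x, 0 < f x,
    (0 < \int[mu]_x (geom_mean_op nrm eps f x `^ q * (u x)%:E))%E &
    (\int[mu]_x (f x `^ p * v x)%:E < +oo)%E].
Proof.
move=> D0 Doo; have [mu_ u0] := wu; have [mv v0] := wv.
have o0 : 0 < qomega nrm by exact: qomega_gt0.
have ei0 : 0 < eps^-1 by rewrite invr_gt0.
have [_ [x /= x0 <-] pos] := ereal_sup_gt D0.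
have bx : pos_set b x by rewrite pos_setE.
have iF := log_tilde_integrable Doo bx pos.
set T := b x in iF; have T0 : 0 < T by [].
(* for s other than 0, b (phi s) >= T' exactly when b s <= T *)
pose T' := qomega nrm * (T / qomega nrm) `^ (- eps^-1).
have T'0 : 0 < T' by rewrite mulr_gt0 ?powR_gt0 ?divr_gt0.
pose g y := Num.max (b y) T' `^ (- eps - 1).
have mx0 y : 0 < Num.max (b y) T' by rewrite lt_max T'0 orbT.
have g0 y : 0 < g y by rewrite powR_gt0.
have mg : measurable_fun setT g.
  apply: (measurableT_comp (measurable_powR _)).
  exact: measurable_maxr.
pose f y := (g y * (v y) `^ (-1)) `^ p^-1.
have f0 y : 0 < f y by rewrite powR_gt0// mulr_gt0// powR_gt0.
have mf : measurable_fun setT f.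
  apply: (measurableT_comp (measurable_powR _)); apply: measurable_funM => //.
  exact: (measurableT_comp (measurable_powR _) mv).
exists f; split => //.
- pose h s := (geom_mean_op nrm eps f (phi s) `^ q * (u (phi s))%:E * (J s)%:E)%E.
  have mop : measurable_fun setT (fun x => geom_mean_op nrm eps f x `^ q * (u x)%:E)%E.
    apply: emeasurable_funM; last exact/measurable_EFinP.
    apply: (measurableT_comp (measurable_poweR _)); exact: measurable_geom_mean_op.
  have op0 y : (0 <= geom_mean_op nrm eps f y `^ q * (u y)%:E)%E.
    by rewrite mule_ge0 ?poweR_ge0// lee_fin ltW.
  have mh : measurable_fun setT h.
    apply: emeasurable_funM; first exact: (measurableT_comp mop mphi).
    by apply/measurable_EFinP; exact: measurable_radial_jac.
  have h0 s : (0 <= h s)%E by rewrite mule_ge0// lee_fin radial_jac_ge0.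
  have hpos s : sublevel b T s -> (0 < h s)%E.
    move=> [bs sT]; rewrite mule_gt0 ?lte_fin ?(radial_jac_gt0 e0 bs)// mule_gt0 ?lte_fin//.
    apply: poweR_gt0; rewrite geom_mean_op_radial//; apply: expeR_gt0.
    pose kap := eps^-1 * qomega nrm `^ (- eps - 1).
    have kap0 : 0 < kap by rewrite mulr_gt0 ?powR_gt0.
    have lnE y : sublevel b T y -> ln (f (phi y)) = p^-1 * (ln kap + ln (tilde nrm eps v y)^-1).
      move=> [by0 yT]; have y0 : y != 0 by rewrite -(gauge_gt0 nrm).
      have Jy := radial_jac_gt0 e0 by0.
      rewrite /f ln_powR tildeE invfM; congr (_ * _).
      have T'le : T' <= b (phi y).
        have ty : 0 < b y / qomega nrm by exact: divr_gt0.
        have tT : b y / qomega nrm <= T / qomega nrm by rewrite ler_pM2r// invr_gt0.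
        have h' : (T / qomega nrm) `^ (- eps^-1) <= (b y / qomega nrm) `^ (- eps^-1).
          exact: powRN_le.
        by rewrite (gauge_radial_pow nrm _ y0); apply: ler_wpM2l; [exact: ltW|exact: h'].
      have -> : g (phi y) = b (phi y) `^ (- eps - 1).
        by rewrite /g; congr (_ `^ _); exact: max_l.
      have kE := gauge_radial_jac e0 by0; rewrite -/kap in kE.
      have bphi : 0 < b (phi y) `^ (- eps - 1).
        by rewrite powR_gt0// gauge_gt0 radial_pow_eq0.
      have h1 : 0 < b (phi y) `^ (- eps - 1) * J y by exact: mulr_gt0.
      have h2 : 0 < (v (phi y))^-1 / J y by rewrite divr_gt0// invr_gt0.
      rewrite -kE powR_inv1 ?(ltW (v0 _))// -lnM//.
      by congr ln; field; rewrite !gt_eqF.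
    have sub : sublevel b (b s) `<=` sublevel b T.
      by move=> y [y0 ys]; split => //; exact: le_trans sT.
    have iF' : mu.-integrable (sublevel b (b s)) (EFin \o (fun y => ln (tilde nrm eps v y)^-1)).
      by apply: integrableS iF.
    have i1 : mu.-integrable (sublevel b (b s)) (EFin \o cst (ln kap)).
      exact: integrable_sublevel_cst mb (measure_gauge_ball nrm) _ _ _.
    have il : mu.-integrable (sublevel b (b s)) (fun y => (ln (f (phi y)))%:E).
      apply: (eq_integrable (mball _) (fun y => (p^-1)%:E *
          ((ln kap)%:E + (ln (tilde nrm eps v y)^-1)%:E))%E).
        by move=> y /set_mem/sub yT; rewrite lnE// -EFinM.
      by apply: integrableZl => //; exact: integrableD.
    have fin := integrable_fin_num (mball _) il.
    by rewrite -(fineK fin) -EFinM ltNyr.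
  rewrite (ge0_integral_radialT nrm e0 mop)//.
  rewrite lt_neqAle eq_sym; apply/andP; split; last first.
    by apply: integral_ge0 => s _; exact: h0.
  apply/eqP => z.
  have zT : (\int[mu]_(s in sublevel b T) h s = 0)%E.
    apply/eqP; rewrite eq_le; apply/andP; split; last exact: integral_ge0.
    rewrite -z; apply: ge0_subset_integral => //.
    - exact: measurable_pos_set.
    - exact: measurable_funTS.
    - by move=> s [].
  have : ae_eq mu (sublevel b T) h (cst 0%E).
    apply/(ae_eq_integral_abs mu (mball T)); first exact: measurable_funTS.
    by rewrite -[RHS]zT; apply: eq_integral => s _; rewrite gee0_abs.
  move=> [A [mA A0 sub]].
  have : (mu (sublevel b T) <= mu A)%E.
    apply: le_measure; rewrite ?inE// => s sT; apply: sub => /(_ sT) /= hs.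
    by have := hpos s sT; rewrite hs ltxx.
  by rewrite measure_gauge_ball ?(ltW T0)// A0 lee_fin leNgt T0.
- have -> : (\int[mu]_x (f x `^ p * v x)%:E = \int[mu]_(x in pos_set b) (g x)%:E)%E.
    rewrite -(ge0_integral_pos_set nrm); last 2 first.
    - exact/measurable_EFinP.
    - by move=> y; rewrite lee_fin ltW.
    apply: eq_integral => y _; congr EFin; rewrite /f -powRrM mulVf ?gt_eqF//.
    rewrite powRr1 ?mulr_ge0 ?powR_ge0 ?(ltW (g0 y))// powR_inv1 ?(ltW (v0 y))//.
    by rewrite divfK ?gt_eqF.
  have -> : pos_set b = sublevel b T' `|` [set y | T' < b y].
    apply/seteqP; split => y; rewrite /pos_set /sublevel /=.
      by move=> y0; have [yT|yT] := leP (b y) T'; [left|right].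
    by move=> [[]//|/(lt_trans T'0)].
  have mgt : measurable [set y | T' < b y] by exact: measurable_set_lt.
  rewrite ge0_integral_setU//; last 3 first.
  - by apply/measurable_EFinP; exact: measurable_funTS.
  - by move=> y _; rewrite lee_fin ltW.
  - by apply/disj_setPS => y [[_ h1] /= h2]; move: h1; rewrite leNgt h2.
  apply: lte_add_pinfty.
    rewrite (eq_integral (fun=> (T' `^ (- eps - 1))%:E)); last first.
      by move=> y /set_mem[_ yT]; rewrite /g max_r.
    rewrite integral_cst// [X in (_ * X < _)%E](_ : _ = T'%:E); last first.
      exact: (measure_gauge_ball nrm (ltW T'0)).
    by rewrite -EFinM ltry.
  apply: (@le_lt_trans _ _ (T' `^ (- eps) / eps)%:E); last exact: ltry.
  rewrite -(integral_volume_powRN mb (measure_gauge_ball nrm) e0 T'0).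
  rewrite (eq_integral (fun y => (b y `^ (- eps - 1))%:E)); last first.
    by move=> y /set_mem/= yT; rewrite /g max_l// ltW.
  apply: ge0_subset_integral => //.
  - exact: measurable_set_le.
  - apply/measurable_EFinP; apply: measurable_funTS.
    exact: (measurableT_comp (measurable_powR _) mb).
  - by move=> y _; rewrite lee_fin powR_ge0.
  - by move=> y /= /ltW.
Qed.

End hardy_constant.

Lemma Dtilde_ge0 (R : realType) (N : nat) (G : homogeneous_group R N.+1)
    (nrm : quasi_norm G) (u v : 'rV[R]_N.+1 -> R) (p q eps : R) :
  (0 <= Dtilde nrm u v p q eps)%E.
Proof.
have x0 : (const_mx 1 : 'rV[R]_N.+1) != 0.
  by apply/eqP => /rowP/(_ ord0)/eqP; rewrite !mxE oner_eq0.
apply: le_trans (ereal_sup_ubound _); last by exists (const_mx 1).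
by rewrite mule_ge0 ?poweR_ge0// lee_fin mulr_ge0 ?powR_ge0.
Qed.

Theorem theorem3p3 (R : realType) (N : nat) (G : homogeneous_group R N.+1)
    (nrm : quasi_norm G) (u v : 'rV[R]_N.+1 -> R) (p q eps : R) :
  is_weight u -> is_weight v ->
  0 < p -> p <= q -> 0 < eps ->
  (Dtilde nrm u v p q eps < +oo)%E ->
  (exists C : R, 0 < C /\ hardy_ineq nrm u v p q eps C) /\
  ((optimal_constant nrm u v p q eps)%:E <=
     ((p / q) `^ q^-1 * expR p^-1)%:E * Dtilde nrm u v p q eps)%E /\
  ((0 < Dtilde nrm u v p q eps)%E ->
     0 < optimal_constant nrm u v p q eps /\
     hardy_ineq nrm u v p q eps (optimal_constant nrm u v p q eps)).
Proof.
move=> wu wv p0 pq e0 Doo.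
have q0 : 0 < q := lt_le_trans p0 pq.
have [d dE] : exists d, Dtilde nrm u v p q eps = d%:E.
  exists (fine (Dtilde nrm u v p q eps)).
  by rewrite fineK// ge0_fin_numE// Dtilde_ge0.
have d0 : 0 <= d by rewrite -lee_fin -dE Dtilde_ge0.
set K := (p / q) `^ q^-1 * expR p^-1.
have K0 : 0 < K by rewrite mulr_gt0 ?powR_gt0 ?expR_gt0 ?divr_gt0.
pose S := [set C : R | 0 < C /\ hardy_ineq nrm u v p q eps C].
have SK e : 0 < e -> S (K * (d + e)).
  move=> e_gt0; have de : 0 < d + e by rewrite ltr_wpDl.
  split; first exact: mulr_gt0.
  by apply: hardy_ineq_Dtilde => //; rewrite dE lee_fin lerDl ltW.
have lbS : has_lbound S by exists 0 => C [/ltW].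
have S0 : S !=set0 by exists (K * (d + 1)); exact: SK.
split; first by exists (K * (d + 1)); exact: SK.
split.
  rewrite dE -EFinM lee_fin -[optimal_constant _ _ _ _ _ _]/(inf S).
  apply/ler_addgt0Pr => e e_gt0.
  have eK : 0 < e / K by rewrite divr_gt0.
  have := ge_inf lbS (SK _ eK); rewrite mulrDr mulrCA mulfV ?gt_eqF// mulr1.
  by [].
move=> Dpos; rewrite -[optimal_constant _ _ _ _ _ _]/(inf S).
have q'0 : 0 < q^-1 by rewrite invr_gt0.
have p'0 : 0 < p^-1 by rewrite invr_gt0.
(* one function with a positive left-hand side and a finite right-hand side
   bounds all admissible constants from below *)
have infS0 : 0 < inf S.
  have [f [mf f0 Lpos Rfin]] := Dtilde_test_function wu wv p0 e0 Dpos Doo.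
  set L := (\int[lebesgue_rV N.+1]_x _)%E in Lpos.
  set r := (\int[lebesgue_rV N.+1]_x _)%E in Rfin.
  have Sle C : S C -> (L `^ q^-1 <= C%:E * r `^ p^-1)%E by case=> _ /(_ f mf f0).
  have L1 : (0 < L `^ q^-1)%E by exact: poweR_gt0.
  have r1 : (r `^ p^-1 < +oo)%E by exact: poweR_lty.
  have [r2 r2E] : exists r2, (r `^ p^-1 = r2%:E)%E.
    by exists (fine (r `^ p^-1)); rewrite fineK// ge0_fin_numE// poweR_ge0.
  have [l lE] : exists l, (L `^ q^-1 = l%:E)%E.
    exists (fine (L `^ q^-1)); rewrite fineK// ge0_fin_numE ?poweR_ge0//.
    have [C SC] := S0; apply: le_lt_trans (Sle C SC) _.
    by rewrite r2E -EFinM ltry.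
  rewrite lE lte_fin in L1; rewrite r2E lE in Sle.
  have r20 : 0 < r2.
    have [C SC] := S0; have [C0 _] := SC; have := Sle C SC.
    by rewrite -EFinM lee_fin => /(lt_le_trans L1); rewrite pmulr_rgt0.
  apply: (@lt_le_trans _ _ (l / r2)); first exact: divr_gt0.
  apply: lb_le_inf => // C SC; rewrite ler_pdivrMr//.
  by have := Sle C SC; rewrite -EFinM lee_fin.
split => // f mf f0.
set L := (X in (X <= _)%E); set r := (X in (_ <= _ * X)%E).
have Sle C : S C -> (L <= C%:E * r)%E by case=> _ /(_ f mf f0).
have r0 : (0 <= r)%E by exact: poweR_ge0.
have [->|roo] := eqVneq r +oo%E; first by rewrite gt0_muley ?lte_fin// leey.
have [s sE] : exists s, r = s%:E.
  by exists (fine r); rewrite fineK// ge0_fin_numE// ltey.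
have [l lE] : exists l, L = l%:E.
  exists (fine L); rewrite fineK// ge0_fin_numE ?poweR_ge0//.
  have [C SC] := S0; apply: le_lt_trans (Sle C SC) _.
  by rewrite sE -EFinM ltry.
rewrite sE lE in Sle *; rewrite -EFinM lee_fin.
move: r0; rewrite sE lee_fin le_eqVlt => /predU1P[s0|s0].
  rewrite -s0 mulr0; have [C SC] := S0; have := Sle C SC.
  by rewrite -s0 mule0 lee_fin.
rewrite -ler_pdivrMr//; apply: lb_le_inf => // C SC; rewrite ler_pdivrMr//.
by have := Sle C SC; rewrite -EFinM lee_fin.
Qed.
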